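(* Let $N\ge1$ be an integer, $s\in(0,1)$, $\Omega\subset\mathbb{R}^N$ an open set, $q\in(1,2)$ and $u\in C_0^\infty(\Omega)$. Then $$\int_\Omega\frac{u^2}{w_{\Omega,s,q}^{2-q}}\,dx\le\int_{\mathbb{R}^N}\int_{\mathbb{R}^N}\frac{(u(x)-u(y))^2}{|x-y|^{N+2s}}\,dx\,dy,$$ with the agreement that the integrand on the left is $0$ at all points where $w_{\Omega,s,q}=+\infty$.
   Context: For a function $u$ on $\mathbb{R}^N$ write $[u]^2=\int_{\mathbb{R}^N}\int_{\mathbb{R}^N}\frac{(u(x)-u(y))^2}{|x-y|^{N+2s}}\,dx\,dy$. Functions in $C_0^\infty(\Omega)$ (smooth, compactly supported in $\Omega$) are extended by $0$ to $\mathbb{R}^N\setminus\Omega$. $\mathcal{D}^{s,2}_0(\Omega)$ is the completion of $C_0^\infty(\Omega)$ with respect to the norm $[\cdot]$. $\lambda_1(\Omega,s,q)=\inf\{[\varphi]^2:\varphi\in C_0^\infty(\Omega),\ \int_\Omega|\varphi|^q\,dx=1\}$; when it is positive, $\mathcal{D}^{s,2}_0(\Omega)$ is identified with a space of functions continuously embedded in $L^q(\Omega)$, extended by $0$ outside $\Omega$. Definition of the $(s,q)$-Lane-Emden density $w_{\Omega,s,q}$, $q\in(1,2)$. If $\lambda_1(\Omega,s,q)>0$ (in particular if $\Omega$ is bounded), $w_{\Omega,s,q}$ is the unique solution of $$\min\Big\{\tfrac12[\varphi]^2-\tfrac1q\int_\Omega\varphi^q\,dx:\ \varphi\in\mathcal{D}^{s,2}_0(\Omega),\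 \varphi\ge0\text{ a.e. in }\Omega\Big\}.$$ For a general open set $\Omega$, $w_{\Omega,s,q}(x)=\lim_{r\to\infty}w_{\Omega\cap B_r,s,q}(x)\in[0,+\infty]$, where $B_r$ is the ball of radius $r$ centred at the origin; the limit exists because $w_{\Omega\cap B_r,s,q}$ (extended by $0$) is non-decreasing in $r$, and the two definitions agree when $\lambda_1(\Omega,s,q)>0$. As usual these functions are defined up to null sets. *)

(* Defs.v *)
From HB Require Import structures.
From mathcomp Require Import all_boot all_order all_algebra.
From mathcomp Require Import all_classical all_reals all_analysis.
(* [all_analysis] does not export the measurable structure on \bar R. *)
From mathcomp Require Import measurable_realfun.

Set Implicit Arguments.
Unset Strict Implicit.
Unset Printing Implicit Defensive.

Import Order.TTheory GRing.Theory Num.Theory.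
Import numFieldNormedType.Exports.

Local Open Scope classical_set_scope.
Local Open Scope ring_scope.

(* The product sigma-algebra on row vectors, generated by the coordinates, as
   the library does for [n.-tuple T]; for [T = R] it is the Borel
   sigma-algebra of R^n. *)
Definition measure_rV_display : measure_display -> measure_display.
Proof. exact. Qed.

Section measurable_rV.
Context {d : measure_display} {T : measurableType d} {n : nat}.

Definition rV_coord (i : 'I_n) (x : 'rV[T]_n) : T := x ord0 i.

Let rV_set0 : g_sigma_preimage rV_coord set0.
Proof. exact: sigma_algebra0. Qed.

Let rV_setC A : g_sigma_preimage rV_coord A -> g_sigma_preimage rV_coord (~` A).
Proof. exact: sigma_algebraC. Qed.

Let rV_bigcup (F : (set 'rV[T]_n)^nat) :
  (forall i, g_sigma_preimage rV_coord (F i)) ->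
  g_sigma_preimage rV_coord (\bigcup_i (F i)).
Proof. exact: sigma_algebra_bigcup. Qed.

HB.instance Definition _ := @isMeasurable.Build (measure_rV_display d)
  ('rV[T]_n) (g_sigma_preimage rV_coord) rV_set0 rV_setC rV_bigcup.

End measurable_rV.

Lemma measurable_rV_coord d (T : measurableType d) n (i : 'I_n) :
  measurable_fun [set: 'rV[T]_n] (rV_coord i).
Proof.
move=> _ Y mY; rewrite setTI; apply: sub_sigma_algebra => /=.
rewrite -bigcup_seq/=; exists i => /=; first by rewrite mem_index_enum.
by exists Y => //; rewrite setTI.
Qed.

Lemma measurable_fun_rVP d1 d2 (T1 : measurableType d1) (T2 : measurableType d2)
    n (f : T1 -> 'rV[T2]_n) :
  (forall i, measurable_fun setT (rV_coord i \o f)) -> measurable_fun setT f.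
Proof.
move=> mf.
have H : g_sigma_preimage (fun i => rV_coord i \o f) `<=` measurable.
  apply: smallest_sub; first exact: sigma_algebra_measurable.
  case: n => [|n] in f mf *; first by rewrite big_ord0.
  rewrite -bigcup_mkord_ord; apply: bigcup_sub => i Ii.
  by move=> A [B mB <-]; exact: mf.
move: H; rewrite g_sigma_preimage_comp => H _ A mA.
by apply: H; exists A.
Qed.

Section lebesgue_rV_succ.
Context {R : realType} {n : nat}.

Definition rV_cons (p : measurableTypeR R * 'rV[R]_n) : 'rV[R]_n.+1 :=
  row_mx (p.1)%:M p.2 : 'rV[R]_(1 + n).

Definition rV_uncons (x : 'rV[R]_n.+1) : measurableTypeR R * 'rV[R]_n :=
  (x ord0 ord0, @rsubmx R 1 1 n x).

Lemma rV_cons0 p : rV_cons p ord0 ord0 = p.1.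
Proof.
transitivity (((p.1)%:M : 'M[R]_1) ord0 ord0); last by rewrite mxE eqxx.
rewrite /rV_cons -[RHS](row_mxEl _ p.2); congr (row_mx _ _ _ _).
exact/val_inj.
Qed.

Lemma rV_consS p i : rV_cons p ord0 (lift ord0 i) = p.2 ord0 i.
Proof.
rewrite /rV_cons -[RHS](row_mxEr (p.1)%:M); congr (row_mx _ _ _ _).
exact/val_inj.
Qed.

Lemma rV_consK : cancel rV_cons rV_uncons.
Proof.
move=> [a v]; congr pair; first exact: rV_cons0.
exact: row_mxKr.
Qed.

Lemma measurable_rV_cons : measurable_fun setT rV_cons.
Proof.
apply: measurable_fun_rVP => i; case: (unliftP ord0 i) => [j|] ->.
  rewrite (_ : _ \o _ = rV_coord j \o snd).
    exact: measurableT_comp (measurable_rV_coord j) measurable_snd.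
  by apply/funext => p; exact: rV_consS.
rewrite (_ : _ \o _ = fst); first exact: measurable_fst.
by apply/funext => p; exact: rV_cons0.
Qed.

Lemma measurable_rV_uncons : measurable_fun setT rV_uncons.
Proof.
apply/measurable_fun_pairP; split; first exact: measurable_rV_coord.
apply: measurable_fun_rVP => i.
rewrite (_ : _ \o _ = rV_coord (rshift 1 i : 'I_n.+1)).
  exact: measurable_rV_coord.
by apply/funext => x; rewrite /rV_coord /= mxE.
Qed.

Variable mu : {sigma_finite_measure set 'rV[R]_n -> \bar R}.

Definition lebesgue_rV_succ : set 'rV[R]_n.+1 -> \bar R :=
  pushforward (lebesgue_measure \x mu)%E rV_cons.

Let lebesgue_rV_succ0 : lebesgue_rV_succ set0 = 0%E.
Proof. by rewrite /lebesgue_rV_succ /pushforward preimage_set0 measure0. Qed.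

Let lebesgue_rV_succ_ge0 A : (0 <= lebesgue_rV_succ A)%E.
Proof. exact: (measure_ge0 (lebesgue_measure \x mu)%E). Qed.

Let lebesgue_rV_succ_sigma_additive : semi_sigma_additive lebesgue_rV_succ.
Proof.
have mf := measurable_rV_cons.
have := @measure_semi_sigma_additive _ _ _
  (pushforward (lebesgue_measure \x mu)%E rV_cons).
by apply.
Qed.

HB.instance Definition _ := isMeasure.Build _ _ _ lebesgue_rV_succ
  lebesgue_rV_succ0 lebesgue_rV_succ_ge0 lebesgue_rV_succ_sigma_additive.

Let lebesgue_rV_succ_sigma_finite : sigma_finite setT lebesgue_rV_succ.
Proof.
have /sigma_finiteP[F [TF ndF Foo]] := sigma_finiteT (@lebesgue_measure R).
have /sigma_finiteP[G [TG ndG Goo]] := sigma_finiteT mu.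
exists (fun k => rV_uncons @^-1` (F k `*` G k)).
  rewrite -preimage_bigcup (_ : \bigcup_k _ = setT) ?preimage_setT//.
  apply/seteqP; split=> // -[x y] _.
  have [n1 _ Fx] : (\bigcup_i F i) x by rewrite -TF.
  have [n2 _ Gy] : (\bigcup_i G i) y by rewrite -TG.
  exists (maxn n1 n2) => //; split.
  - by move: x Fx; exact/subsetPset/ndF/leq_maxl.
  - by move: y Gy; exact/subsetPset/ndG/leq_maxr.
move=> k; have [mF Fk] := Foo k; have [mG Gk] := Goo k; split.
  rewrite -[X in measurable X]setTI; apply: measurable_rV_uncons => //.
  exact: measurableX.
rewrite /lebesgue_rV_succ /pushforward -comp_preimage.
rewrite (_ : rV_uncons \o rV_cons = id); last exact/funext/rV_consK.
by rewrite preimage_id product_measure1E// lte_mul_pinfty// ge0_fin_numE.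
Qed.

HB.instance Definition _ := Measure_isSigmaFinite.Build _ _ _
  lebesgue_rV_succ lebesgue_rV_succ_sigma_finite.

End lebesgue_rV_succ.

(* Lebesgue measure on the Borel sigma-algebra of R^n. *)
Fixpoint lebesgue_rV {R : realType} (n : nat) :
    {sigma_finite_measure set 'rV[R]_n -> \bar R} :=
  match n with
  | 0 => \d_(0 : 'rV[R]_0)
  | n'.+1 => lebesgue_rV_succ (lebesgue_rV n')
  end.

Lemma lebesgue_rV_box {R : realType} n (A : 'I_n -> set R) :
  (forall i, measurable (A i)) ->
  lebesgue_rV n [set x | forall i, A i (x ord0 i)] =
  (\prod_(i < n) lebesgue_measure (A i))%E.
Proof.
elim: n A => [|n ih] A mA.
  by rewrite big_ord0 /= diracE mem_set//= => -[].
rewrite big_ord_recl -ih//= /lebesgue_rV_succ /pushforward.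
rewrite -product_measure1E//.
  congr (_ _); apply/seteqP; split => -[a v] /=.
    by move=> H; split=> [|i]; [have := H ord0|have := H (lift ord0 i)];
      rewrite ?rV_cons0 ?rV_consS.
  move=> [Aa Av] i; case: (unliftP ord0 i) => [j|] ->.
    by rewrite rV_consS; exact: Av.
  by rewrite rV_cons0.
exact: mA.
rewrite (_ : (fun x => _) =
    \bigcap_(i in [set: 'I_n]) (rV_coord i @^-1` (A (lift ord0 i)))).
  apply: fin_bigcap_measurable => [|i _]; first exact: finite_finset.
  by rewrite -[X in measurable X]setTI; apply: measurable_rV_coord => //.
by apply/seteqP; split=> x /= H i; [move=> _; exact: H|exact: (H i)].
Qed.

Section lane_emden.
Context {R : realType} {n : nat}.
Local Notation E := 'rV[R]_n.
Implicit Types (s q : R) (D : set E) (u v phi : E -> R).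

(* The library norm on row vectors is the sup norm. *)
Definition enorm (x : E) : R := Num.sqrt (\sum_(i < n) x ord0 i ^+ 2).

Definition eball (r : R) : set E := [set x | enorm x < r].

(* The squared Gagliardo seminorm [u]^2. *)
Definition gagliardo2 s u : \bar R :=
  (\int[lebesgue_rV n]_x \int[lebesgue_rV n]_y
     ((u x - u y) ^+ 2 / enorm (x - y) `^ (n%:R + 2 * s))%:E)%E.

Definition iter_partial (l : seq 'I_n) u : E -> R :=
  foldr (fun i f => 'D_(delta_mx ord0 i) f) u l.

Definition smooth u : Prop := forall l : seq 'I_n,
  continuous (iter_partial l u) /\
  forall i x, derivable (iter_partial l u) x (delta_mx ord0 i).

Definition supp u : set E := closure [set x | u x != 0].

(* C_0^oo(D); its elements, being defined on R^n and vanishing off D, are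
   already extended by 0. *)
Definition test_function D u : Prop :=
  [/\ smooth u, compact (supp u) & supp u `<=` D].

(* The q-th power of the norm of u in L^q(D). *)
Definition Lq_powint q D u : \bar R :=
  (\int[lebesgue_rV n]_(x in D) (`|u x| `^ q)%:E)%E.

Definition lambda1 s q D : \bar R :=
  ereal_inf [set gagliardo2 s phi | phi in
    [set phi | test_function D phi /\ Lq_powint q D phi = 1%E]].

(* The completion D^{s,2}_0(D), realised inside L^q(D): v is the L^q-limit of a
   sequence of test functions that is Cauchy for the Gagliardo seminorm. This
   is used only when lambda1 s q D > 0, where the L^q-limit of such a sequence
   exists and determines the element of the completion. Functions stand for
   their classes modulo null sets, with Borel representatives. *)
Definition D0s2 s q D v : Prop :=
  [/\ measurable_fun [set: E] v,
      {ae lebesgue_rV n, forall x, ~ D x -> v x = 0} &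
      exists phi : nat -> E -> R,
        [/\ forall k, test_function D (phi k),
            forall e : R, 0 < e -> exists K, forall j k,
              (K <= j)%N -> (K <= k)%N ->
              (gagliardo2 s (phi j \- phi k)%R < e%:E)%E &
            Lq_powint q D (phi k \- v) @[k --> \oo] --> 0%E]].

Definition energy s q D v : \bar R :=
  (2^-1%:E * gagliardo2 s v
   - q^-1%:E * \int[lebesgue_rV n]_(x in D) (v x `^ q)%:E)%E.

Definition admissible s q D v : Prop :=
  D0s2 s q D v /\ {ae lebesgue_rV n, forall x, D x -> 0 <= v x}.

Definition energy_minimizer s q D v : Prop :=
  admissible s q D v /\
  forall phi, admissible s q D phi -> (energy s q D v <= energy s q D phi)%E.

(* w is (a Borel representative of) the (s,q)-Lane-Emden density of D, in
   either sense: the minimizer when lambda1 > 0, or the limit of the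
   minimizers on D `&` B_r for an arbitrary D. *)
Definition lane_emden_density s q D (w : E -> \bar R) : Prop :=
  measurable_fun [set: E] w /\
  ((0 < lambda1 s q D)%E /\
     (exists2 v, energy_minimizer s q D v &
        {ae lebesgue_rV n, forall x, w x = (v x)%:E})
   \/
   exists2 v : R -> E -> R,
     forall r, 0 < r -> energy_minimizer s q (D `&` eball r) (v r) &
     {ae lebesgue_rV n, forall x, (v r x)%:E @[r --> +oo] --> w x}).

End lane_emden.

(* Main.v *)
(* The minimiser [w] satisfies [w, psi] >= \int w^(q-1) psi for every nonnegative
   test function psi, where [., .] is the bilinear form of the Gagliardo
   seminorm.  Taking psi = u^2 / (w + e) and using the discrete Picone inequality
     (a - b) (x^2 / a - y^2 / b) <= (x - y)^2
   bounds \int w^(q-1) u^2 / (w + e) by [u]^2, and e -> 0 gives the claim on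
   {w > 0}.  The function psi need not be smooth, so [w] is first replaced in it
   by smooth approximations phi_k, through a smooth substitute for 1 / (t + e);
   a Fatou argument that only uses lower semicontinuity passes to the limit.
   The remainder in Picone's inequality also controls {w = 0}: since the form is
   nonlocal, either u vanishes a.e. there or w = 0 a.e., and the latter forces
   u = 0 because q < 2.  Densities of unbounded sets follow by Fatou's lemma. *)

Require Import Defs.
From mathcomp Require Import all_boot all_order all_algebra.
From mathcomp Require Import all_classical all_reals all_analysis.
From mathcomp Require Import measurable_realfun.
From mathcomp Require Import ring lra.

Set Implicit Arguments.
Unset Strict Implicit.
Unset Printing Implicit Defensive.

Import Order.TTheory GRing.Theory Num.Theory.
Import numFieldNormedType.Exports.

Local Open Scope classical_set_scope.
Local Open Scope ring_scope.

(** * Borel sets of row vectors *)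

(** The obstacle: [psi] must be built from a smooth [phi_k] to give an admissible perturbation, but
    then [dif v * dif psi] is no longer dominated by [dif u ^+ 2], since Picone's inequality needs
    the same function in both factors. Moreover the bilinear form is a signed integral, to which
    Fatou's lemma does not apply directly. Both difficulties are met by stating the Euler-Lagrange
    inequality with a free majorant [Q] of [dif v * dif psi]: only the nonnegative functions [Q] and
    [Q - dif v * dif psi] are integrated. Along the approximation [Q] is a crude Lipschitz bound of
    finite integral; in the limit it is cancelled and [dif u ^+ 2] takes its place. The [phi_k] may
    change sign, hence a substitute for [1 / (t + e)] that is smooth on the whole line; Picone's
    inequality is invoked only for [v >= 0]. Finiteness of the seminorm of a general test function
    is never established: the claim is trivial if [[u]] is infinite, and otherwise the finiteness
    required comes from [[u]], minimality and the Cauchy property. *)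

Section borel_rV.
Context {R : realType} {n : nat}.
Local Notation E := 'rV[R]_n.

Lemma measurable_rV_box (c : E) (r : R) :
  measurable [set x : E | forall i, `|x ord0 i - c ord0 i| < r].
Proof.
rewrite (_ : mkset _ =
    \bigcap_(i in [set: 'I_n]) (rV_coord i @^-1` [set t | `|t - c ord0 i| < r])).
  apply: fin_bigcap_measurable => [|i _]; first exact: finite_finset.
  rewrite -[X in measurable X]setTI; apply: measurable_rV_coord => //.
  rewrite (_ : mkset _ = `]c ord0 i - r, c ord0 i + r[%classic)//.
  by apply/seteqP; split => t /=; rewrite in_itv/= ltr_distl.
by apply/seteqP; split=> x /= H i; [move=> _; exact: H|exact: (H i)].
Qed.

(** The sigma-algebra is generated by the coordinates, so open sets are reached through boxes: [A]
    is the union of the countably many boxes with rational centre and radius [1 / p.2.+1] that it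
    contains. *)
Lemma open_measurable_rV (A : set E) : open A -> measurable A.
Proof.
move=> oA.
pose box (p : 'rV[rat]_n * nat) : set E :=
  [set x | forall i, `|x ord0 i - ratr (p.1 ord0 i)| < p.2.+1%:R^-1].
have mbox p : measurable (box p).
  have := measurable_rV_box (\row_i ratr (p.1 ord0 i)) p.2.+1%:R^-1.
  by congr measurable; apply/seteqP; split => x /= H i; have := H i; rewrite mxE.
pose F k := if unpickle k is Some p
  then (if `[< box p `<=` A >] then box p else set0) else set0.
suff -> : A = \bigcup_k F k.
  apply: bigcupT_measurable => k; rewrite /F; case: (unpickle k) => // p.
  by case: ifP.
apply/seteqP; split=> [x Ax|x [k _]]; last first.
  by rewrite /F; case: (unpickle k) => // p; case: ifPn => // /asboolP pA /pA.
have /nbhs_ballP[e /= e0 xeA] : nbhs x A by apply: open_nbhs_nbhs.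
(* Radius below [e / 2]: both [x] and any point of the box are that close to the rational centre, so
   the box lies in the ball of radius [e] about [x]. *)
have [k _ /(_ _ (leqnn k)) ke] := near_infty_natSinv_lt (PosNum (divr_gt0 e0 (@ltr0n R 2))).
have k0 : 0 < k.+1%:R^-1 :> R by rewrite invr_gt0.
have /choice[c xc] : forall i, exists c : rat, `|x ord0 i - ratr c| < k.+1%:R^-1.
  move=> i; have [|c] := @rat_in_itvoo R (x ord0 i - k.+1%:R^-1) (x ord0 i + k.+1%:R^-1).
    by rewrite ltrD2l; apply: lt_trans k0; rewrite oppr_lt0.
  by rewrite in_itv/= -ltr_distl distrC => ?; exists c.
exists (pickle (\row_i c i, k)) => //; rewrite /F pickleK.
case: ifPn => [_ i|/asboolPn]; first by rewrite mxE.
case=> y yb; apply: xeA; split=> // i j; rewrite (ord1 i) /ball/=.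
have := yb j; rewrite mxE/= => yj; have := xc j => xj.
rewrite (splitr e) (le_lt_trans (ler_distD (ratr (c j)) _ _))// ltrD//.
  exact: lt_trans ke.
by rewrite distrC; apply: lt_trans ke.
Qed.

Lemma continuous_measurable_rV (f : E -> R) :
  continuous f -> measurable_fun setT f.
Proof.
move=> /continuousP cf; apply: (measurability (@RGenOpens.G R)).
  exact: RGenOpens.measurableE.
move=> _ [_ [a [b ->]] <-]; rewrite setTI.
by apply: open_measurable_rV; apply: cf; exact: interval_open.
Qed.

End borel_rV.

(** * Smooth functions *)

Section smooth_functions.
Context {R : realType} {n : nat}.
Local Notation E := 'rV[R]_n.
Local Notation e_ i := (delta_mx ord0 i : E).
Implicit Types f g : E -> R.

(** The recursion peels off the derivative nearest to [f], whereas [iter_partial] adds derivatives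
    on the outside. In this form closure under sums, products and inverse square roots follows by
    induction on the order. *)
Fixpoint Ck (k : nat) f : Prop :=
  continuous f /\
  if k is k'.+1 then
    forall i, (forall x, derivable f x (e_ i)) /\ Ck k' ('D_(e_ i) f)
  else True.

Lemma CkW k f : Ck k.+1 f -> Ck k f.
Proof.
elim: k f => [|k IH] f [cf df]; first by split.
by split=> // i; have [dfi Cfi] := df i; split=> //; exact: IH.
Qed.

Lemma iter_partial_rcons (l : seq 'I_n) i f :
  iter_partial (rcons l i) f = iter_partial l ('D_(e_ i) f).
Proof. by rewrite /iter_partial foldr_rcons. Qed.

Lemma smoothP f : smooth f <-> forall k, Ck k f.
Proof.
split=> [sf k|Cf l].
  elim: k f sf => [|k IH] f sf; first by split=> //; have [] := sf [::].
  split=> [|i]; first by have [] := sf [::].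
  split=> [x|]; first by have [_] := sf [::]; exact.
  by apply: IH => l; rewrite -iter_partial_rcons; exact: sf.
elim/last_ind: l f Cf => [|l i IH] f Cf.
  by split; [have [] := Cf 0|move=> i x; have [_ /(_ i)[]] := Cf 1].
rewrite iter_partial_rcons; apply: IH => k.
by have [_ /(_ i)[]] := Cf k.+1.
Qed.

Lemma smooth_continuous f : smooth f -> continuous f.
Proof. by move=> /(_ [::])[]. Qed.

Lemma Ck_cst k (c : R) : Ck k (cst c).
Proof.
elim: k c => [|k IH] c; first by split=> [x|//]; exact: cst_continuous.
split=> [x|i]; first exact: cst_continuous.
split=> [x|]; first exact: derivable_cst.
rewrite (_ : 'D_ _ _ = cst 0) //; apply/funext => x; exact: derive_cst.
Qed.

Lemma CkD k f g : Ck k f -> Ck k g -> Ck k (f + g).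
Proof.
elim: k f g => [|k IH] f g [cf df] [cg dg].
  by split=> [x|//]; apply: continuousD; [exact: cf|exact: cg].
split=> [x|i]; first by apply: continuousD; [exact: cf|exact: cg].
have [dfi Cfi] := df i; have [dgi Cgi] := dg i.
split=> [x|]; first exact: derivableD.
rewrite (_ : 'D_ _ _ = 'D_(e_ i) f + 'D_(e_ i) g); first exact: IH.
by apply/funext => x; exact: deriveD.
Qed.

Lemma CkM k f g : Ck k f -> Ck k g -> Ck k (f * g).
Proof.
elim: k f g => [|k IH] f g Cf Cg.
  by split=> [x|//]; apply: continuousM; [exact: Cf.1|exact: Cg.1].
split=> [x|i]; first by apply: continuousM; [exact: Cf.1|exact: Cg.1].
have [dfi Cfi] := Cf.2 i; have [dgi Cgi] := Cg.2 i.
split=> [x|]; first exact: derivableM.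
rewrite (_ : 'D_ _ _ = f * 'D_(e_ i) g + g * 'D_(e_ i) f); last first.
  by apply/funext => x; exact: deriveM.
by apply: CkD; apply: IH => //; exact: CkW.
Qed.

Lemma derivable1_comp (F h : R -> R) (t : R) :
  derivable F t 1 -> derivable h (F t) 1 -> derivable (h \o F) t 1.
Proof.
move=> /derivable1_diffP dF /derivable1_diffP dh.
by apply/derivable1_diffP; exact: differentiable_comp.
Qed.

(** Restriction to a line makes a directional derivative a one-variable derivative, so that the
    chain rule for [h \o f] asks for derivability of [f] in the direction [v] only, not for
    differentiability. *)
Lemma is_derive_line f (x v : E) (df : R) :
  is_derive x v f df <-> is_derive (0 : R) 1 (fun t : R => f (t *: v + x)) df.
Proof.
have DE : 'D_v f x = 'D_1 (fun t : R => f (t *: v + x)) 0.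
  rewrite /derive; set g1 := fun k => _; set g2 := fun k => k^-1 *: _.
  suff -> : g1 = g2 by [].
  by apply/funext => t; rewrite /g1 /g2/= addr0 scale0r add0r [_%:A]mulr1.
split=> -[d e]; split.
- exact: (derivable1P f x v).1.
- by rewrite -DE.
- exact: (derivable1P f x v).2.
- by rewrite DE.
Qed.

Lemma is_derive_comp f (h : R -> R) (x v : E) (df dh : R) :
  is_derive x v f df -> is_derive (f x) 1 h dh ->
  is_derive x v (h \o f) (dh * df).
Proof.
move=> /is_derive_line; set F := fun t : R => _ => DF Dh.
have F0 : F 0 = f x by rewrite /F scale0r add0r.
apply/is_derive_line; rewrite -[fun t : R => _]/(h \o F).
rewrite -F0 in Dh; clearbody F; case: DF => dF <-; case: Dh => dh0 <-.
split; first exact: (derivable1_comp dF dh0).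
by rewrite -(derive1E (h \o F)) (derive1_comp dF dh0) (derive1E h) (derive1E F).
Qed.

(** A partial derivative of [G = f^(-1/2)] is [-1/2 G^3] times that of [f]: a product of functions
    already known to be of class one order lower, so the induction closes by [CkM]. *)
Lemma Ck_inv_sqrt k f : (forall x, 0 < f x) -> Ck k f ->
  Ck k (fun x => (Num.sqrt (f x))^-1).
Proof.
move=> f0.
have f0' x : Num.sqrt (f x) != 0 by rewrite gt_eqF// sqrtr_gt0.
have cG : continuous f -> continuous (fun x => (Num.sqrt (f x))^-1).
  move=> cf x.
  have cs : {for x, continuous (Num.sqrt \o f)}.
    by apply: continuous_comp; [exact: cf|exact: sqrt_continuous].
  by have := @continuousV _ _ (Num.sqrt \o f) x (f0' x) cs.
elim: k => [|k IH] Cf; first by split=> //; apply: cG; exact: Cf.1.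
split=> [|i]; first by apply: cG; exact: Cf.1.
set G := fun x => _.
have DG x : is_derive x (e_ i) G ((cst (- 2^-1) * G * G * G * 'D_(e_ i) f) x).
  have Df : is_derive x (e_ i) f ('D_(e_ i) f x).
    by apply: derivableP; exact: (Cf.2 i).1.
  have [ds Es] := is_derive_comp Df (is_derive1_sqrt (f0 x)).
  have dV := derivableV (f := Num.sqrt \o f) (f0' x) ds.
  have EV := deriveV (f := Num.sqrt \o f) (f0' x) ds.
  rewrite Es in EV; split; first exact: dV.
  rewrite -[G]/(fun y => ((Num.sqrt \o f) y)^-1) EV.
  rewrite /G /= !fctE /= /GRing.scale /=.
  have := f0' x; move: (Num.sqrt (f x)) => s s0.
  by field.
split=> [x|]; first exact: ex_derive.
rewrite (_ : 'D_ _ _ = cst (- 2^-1) * G * G * G * 'D_(e_ i) f).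
  have CG := IH (CkW Cf).
  by repeat apply: CkM => //; [exact: Ck_cst|exact: (Cf.2 i).2].
by apply/funext => x; rewrite derive_val.
Qed.

Lemma smooth_cst (c : R) : smooth (cst c : E -> R).
Proof. by apply/smoothP => k; exact: Ck_cst. Qed.

Lemma smoothD f g : smooth f -> smooth g -> smooth (f + g).
Proof. by move=> /smoothP sf /smoothP sg; apply/smoothP => k; exact: CkD. Qed.

Lemma smoothM f g : smooth f -> smooth g -> smooth (f * g).
Proof. by move=> /smoothP sf /smoothP sg; apply/smoothP => k; exact: CkM. Qed.

Lemma smooth_inv_sqrt f : (forall x, 0 < f x) -> smooth f ->
  smooth (fun x => (Num.sqrt (f x))^-1).
Proof.
move=> f0 /smoothP sf; apply/smoothP => k.
by apply: Ck_inv_sqrt.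
Qed.

Lemma test_functionD (D : set E) f g :
  test_function D f -> test_function D g -> test_function D (f + g).
Proof.
move=> [sf cf fD] [sg cg gD].
have fg : supp (f + g) `<=` supp f `|` supp g.
  rewrite /supp -closureU; apply: closure_subset => x /=.
  rewrite !fctE; case: (eqVneq (f x) 0) => [->|]; last by left.
  by rewrite add0r; right.
split; [exact: smoothD| |by move=> x /fg[/fD|/gD]].
apply: (subclosed_compact _ (compactU cf cg)) => //; exact: closed_closure.
Qed.

Lemma test_functionMl (D : set E) f g :
  test_function D f -> smooth g -> test_function D (f * g).
Proof.
move=> [sf cf fD] sg.
have fg : supp (f * g) `<=` supp f.
  by apply: closure_subset => x /=; rewrite !fctE mulf_eq0 negb_or => /andP[].
split; [exact: smoothM| |by move=> x /fg /fD].
by apply: (subclosed_compact _ cf) => //; exact: closed_closure.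
Qed.

Lemma test_functionZ (D : set E) f (c : R) :
  test_function D f -> test_function D (fun x => f x * c).
Proof. by move=> tf; apply: (test_functionMl tf (smooth_cst c)). Qed.

Lemma test_function_out (D : set E) f x : test_function D f -> ~ D x -> f x = 0.
Proof.
move=> [_ _ fD] Dx; apply/eqP/negPn/negP => fx; apply: Dx; apply: fD.
exact: subset_closure.
Qed.

Lemma test_function_bounded (D : set E) f : test_function D f ->
  exists2 M : R, 0 < M & forall x, `|f x| <= M.
Proof.
move=> [sf cf _].
have /continuous_compact/(_ cf)/compact_bounded[M [_ /(_ (`|M| + 1))]] :
    {within supp f, continuous f}.
  by apply: continuous_subspaceT; exact: smooth_continuous.
move=> /(_ (le_lt_trans (ler_norm M) (ltr_pwDr ltr01 (lexx _)))) fM.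
exists (`|M| + 1); first by rewrite ltr_wpDl.
move=> x; have [->|fx0] := eqVneq (f x) 0; first by rewrite normr0 addr_ge0.
by apply: fM; exists x => //; exact: subset_closure.
Qed.

Lemma test_function_supp_bounded (D : set E) f : test_function D f ->
  exists2 M : R, 0 < M & forall x, supp f x -> forall i, `|x ord0 i| <= M.
Proof.
move=> [_ + _] => /compact_bounded[M [_ /(_ (`|M| + 1))]].
move=> /(_ (le_lt_trans (ler_norm M) (ltr_pwDr ltr01 (lexx _)))) fM.
exists (`|M| + 1) => [|x sx i]; first by rewrite ltr_wpDl.
have := fM x sx; apply: le_trans.
by rewrite [leRHS]/Num.Def.normr/= mx_normrE; apply/bigmax_geP; right; exists (ord0, i).
Qed.

End smooth_functions.

(** * Limits of integrals *)

Section limits_of_integrals.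
Local Open Scope ereal_scope.

(** Superadditivity of the lower limit; it lets two separate Fatou estimates share one convergent
    upper bound. *)
Lemma limn_einfD_le (R : realType) (a b c : (\bar R)^nat) (l : \bar R) :
  (forall k, 0 <= a k) -> (forall k, 0 <= b k) ->
  (forall k, a k + b k <= c k) -> c @ \oo --> l ->
  limn_einf a + limn_einf b <= l.
Proof.
move=> a0 b0 abc cl; rewrite !limn_einf_lim.
have einf_ge0 (u : (\bar R)^nat) k : (forall k, 0 <= u k) -> 0 <= einfs u k.
  by move=> u0; apply: le_ereal_inf_tmp => _ [i _ <-].
have einf_le (u : (\bar R)^nat) k : einfs u k <= u k.
  by apply: ereal_inf_lbound; exists k => //=.
have cvgD : (einfs a k + einfs b k)%E @[k --> \oo] -->
    limn (einfs a) + limn (einfs b).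
  apply: cvgeD; [|exact: is_cvg_einfs|exact: is_cvg_einfs].
  by apply: ge0_adde_def; rewrite inE; apply: lime_ge;
    [exact: is_cvg_einfs|apply: nearW => k; exact: einf_ge0
    |exact: is_cvg_einfs|apply: nearW => k; exact: einf_ge0].
apply: (lee_cvg_to cvgD cl); apply: nearW => k.
by apply: le_trans (abc k); apply: leeD; exact: einf_le.
Qed.

Context {d : measure_display} {T : measurableType d} {R : realType}.
Variable mu : {measure set T -> \bar R}.
Implicit Types (D : set T) (f : (T -> \bar R)^nat) (g : T -> \bar R).

(** Where [g] vanishes the bound is free, as the [f k] are nonnegative. The alternative [g x = 0]
    serves the points where convergence fails or is irrelevant: off or on the zero set of the
    minimiser, and where a density is infinite. *)
Lemma ae_fatou D f g : measurable D ->
  (forall k, measurable_fun D (f k)) -> (forall k x, D x -> 0 <= f k x) ->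
  measurable_fun D g -> (forall x, D x -> 0 <= g x) ->
  {ae mu, forall x, D x -> f ^~ x @ \oo --> g x \/ g x = 0} ->
  \int[mu]_(x in D) g x <= limn_einf (fun k => \int[mu]_(x in D) f k x).
Proof.
move=> mD mf f0 mg g0 fg.
have einf0 x : D x -> 0 <= limn_einf (f ^~ x).
  move=> Dx; rewrite limn_einf_lim; apply: lime_ge; first exact: is_cvg_einfs.
  by apply: nearW => k; apply: le_ereal_inf_tmp => _ [i _ <-]; exact: f0.
apply: le_trans (fatou mu mD mf f0).
apply: ae_ge0_le_integral => //.
  rewrite (_ : (fun x => _) = (fun x => - limn_esup (fun n => - f n x))).
    apply: measurableT_comp => //; apply: measurable_fun_limn_esup => k.
    exact: measurableT_comp.
  by apply/funext => x; rewrite -limn_einfN; congr limn_einf;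
    apply/funext => k /=; rewrite oppeK.
apply: filterS fg => x fg Dx.
have [fgx|->] := fg Dx; last exact: einf0.
by rewrite (cvg_limn_einf_sup fgx).1.
Qed.

Lemma ae_fatou_le D f g (c : (\bar R)^nat) (l : \bar R) : measurable D ->
  (forall k, measurable_fun D (f k)) -> (forall k x, D x -> 0 <= f k x) ->
  measurable_fun D g -> (forall x, D x -> 0 <= g x) ->
  {ae mu, forall x, D x -> f ^~ x @ \oo --> g x \/ g x = 0} ->
  (forall k, \int[mu]_(x in D) f k x <= c k) -> c @ \oo --> l ->
  \int[mu]_(x in D) g x <= l.
Proof.
move=> mD mf f0 mg g0 fg fc cl.
apply: le_trans (ae_fatou mD mf f0 mg g0 fg) _.
rewrite -[leLHS]adde0.
have /cvg_limn_einf_sup[<- _] : (cst 0 : (\bar R)^nat) @ \oo --> (0 : \bar R).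
  exact: cvg_cst.
apply: limn_einfD_le cl => // k; first by apply: integral_ge0 => x; exact: f0.
by rewrite adde0.
Qed.

(** Indices are chosen so that the integrals are at most [2^-(k+1)]. The sum of the chosen functions
    is then integrable, hence finite almost everywhere, and its terms tend to 0. The bound
    [k <= j k] already sends [j k] to infinity. *)
Lemma cvg_integral0_ae_subseq D f : measurable D ->
  (forall k, measurable_fun D (f k)) -> (forall k x, D x -> 0 <= f k x) ->
  \int[mu]_(x in D) f k x @[k --> \oo] --> 0 ->
  exists2 j : nat -> nat, (forall k, (k <= j k)%N) &
    {ae mu, forall x, D x -> f (j k) x @[k --> \oo] --> 0}.
Proof.
move=> mD mf f0 fcvg.
have /choice[j jP] : forall k, exists j, (k <= j)%N /\
    \int[mu]_(x in D) f j x <= (1 / (2 ^ k.+1)%:R)%:E.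
  move=> k; have e0 : (0 < 1 / (2 ^ k.+1)%:R :> R)%R.
    by rewrite divr_gt0// ltr0n expn_gt0.
  have /fine_cvgP[ffin /cvgrPdist_lt/(_ _ e0)fe] := fcvg.
  have [N _ NP] := filterI ffin fe.
  have [finN ltN] := NP (maxn k N) (leq_maxr k N).
  exists (maxn k N); split; first exact: leq_maxl.
  rewrite -(fineK finN) lee_fin ltW//; apply: le_lt_trans ltN.
  by rewrite /= sub0r normrN ler_norm.
exists j; first by move=> k; have [] := jP k.
pose s x := \sum_(0 <= k <oo) f (j k) x.
have soo : \int[mu]_(x in D) s x < +oo.
  rewrite integral_nneseries//; last by move=> k x; exact: f0.
  apply: le_lt_trans (ltry 1).
  apply: le_trans (epsilon_trick0 xpredT (@ler01 R)).
  by apply: lee_nneseries => k *; [apply: integral_ge0 => x; exact: f0|exact: (jP k).2].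
have s0 x : D x -> 0 <= s x.
  by move=> Dx; apply: nneseries_ge0 => k _ _; exact: f0.
have ints : mu.-integrable D s.
  apply/integrableP; split.
    apply: (ge0_emeasurable_sum (h := fun k => f (j k)) (P := xpredT)) => //.
    by move=> k x Dx _; exact: f0.
  rewrite (_ : \int[mu]_(x in D) _ = \int[mu]_(x in D) s x)//.
  by apply: eq_integral => x; rewrite inE => Dx; rewrite gee0_abs// s0.
apply: filterS (integrable_ae mD ints) => x sx Dx.
have sxoo : s x < +oo by rewrite -ge0_fin_numE ?sx// s0.
(* The tail from index [k] dominates its first term [f (j k) x], and the tails of a convergent
   series vanish. *)
have tl := nneseries_tail_cvg sxoo (fun k _ => f0 (j k) x Dx).
apply: (squeeze_cvge _ (cvg_cst _) tl); apply: nearW => k; rewrite f0//=.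
have := @nneseries_lim_ge R (fun k => f (j k) x) xpredT k k.+1 (fun i _ _ => f0 (j i) x Dx).
by rewrite big_nat1.
Qed.

End limits_of_integrals.

Section product_ae.
Local Open Scope ereal_scope.
Context {d : measure_display} {T : measurableType d} {R : realType}.
Variable mu : {sigma_finite_measure set T -> \bar R}.

Lemma ae_product (P : T -> Prop) : {ae mu, forall x, P x} ->
  {ae mu \x mu, forall z, P z.1 /\ P z.2}.
Proof.
move=> [N [mN muN PN]].
have n1 : (mu \x mu).-negligible (N `*` setT).
  apply/negligibleP; first exact: measurableX.
  apply: etrans (product_measure1E mu mu mN measurableT) _.
  by apply: etrans (mul0e _); congr (_ * _).
have n2 : (mu \x mu).-negligible (setT `*` N).
  apply/negligibleP; first exact: measurableX.
  apply: etrans (product_measure1E mu mu measurableT mN) _.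
  by apply: etrans (mule0 _); congr (_ * _).
apply: negligibleS (negligibleU n1 n2) => -[x y] /= nP.
have [Px|nPx] := pselect (P x); last by left; split => //; exact: PN.
have [Py|nPy] := pselect (P y); last by right; split => //; exact: PN.
by exfalso; apply: nP.
Qed.

End product_ae.

(** * Euler-Lagrange inequality *)

(* Young's inequality for [a^(q-1)] and [a+h]. *)
Lemma powR_tangent (R : realType) (a h q : R) : 0 <= a -> 0 <= h -> 1 < q ->
  a `^ q + q * (a `^ (q - 1) * h) <= (a + h) `^ q.
Proof.
move=> a0 h0 q1.
have q0 : 0 < q by lra.
have q10 : 0 < q - 1 by lra.
have pq : (q / (q - 1))^-1 + q^-1 = 1 by field; lra.
have := conjugate_powR (powR_ge0 a (q - 1)) (addr_ge0 a0 h0) (divr_gt0 q0 q10) q0 pq.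
have -> : (a `^ (q - 1)) `^ (q / (q - 1)) = a `^ q.
  by rewrite -powRrM; congr (_ `^ _); field; lra.
have aq := mulr_powRB1 a0 q0.
set A := a `^ q in aq *; set B := (a + h) `^ q; set C := a `^ (q - 1) in aq *.
rewrite -(ler_pM2l q0).
have -> : q * (A / (q / (q - 1)) + B / q) = (q - 1) * A + B by field; lra.
rewrite mulrDr (mulrC C a) aq; lra.
Qed.

Section quadratic_form.
Context {d : measure_display} {T : measurableType d} {R : realType}.
Variable mu : {sigma_finite_measure set T -> \bar R}.
Variable K : T * T -> R.
Hypotheses (mK : measurable_fun setT K) (K0 : forall z, 0 <= K z).
Implicit Types (h Q : T * T -> R) (f u v w psi : T -> R) (D : set T).

(** The kernel stays abstract: measurability and nonnegativity are assumed here, and positivity off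
    the diagonal enters with the zero set. [kint] is applied to nonnegative integrands, so that it
    is additive even at infinite values. *)
Definition kint h : \bar R := (\int[mu \x mu]_z (h z * K z)%:E)%E.
Definition dif f (z : T * T) : R := f z.1 - f z.2.
Definition form f : \bar R := kint (fun z => dif f z ^+ 2).
Definition powint (q : R) D f : \bar R := (\int[mu]_(x in D) (f x `^ q)%:E)%E.

Lemma measurable_dif f : measurable_fun setT f -> measurable_fun setT (dif f).
Proof.
move=> mf; apply: measurable_funB.
  exact: (measurableT_comp mf measurable_fst).
exact: (measurableT_comp mf measurable_snd).
Qed.

Lemma measurable_kint h : measurable_fun setT h ->
  measurable_fun setT (fun z => (h z * K z)%:E).
Proof. by move=> mh; apply/measurable_EFinP; exact: measurable_funM. Qed.

Lemma kint_ge0 h : (forall z, 0 <= h z) -> (0 <= kint h)%E.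
Proof.
by move=> h0; apply: integral_ge0 => z _; rewrite lee_fin mulr_ge0.
Qed.

Lemma kintD h1 h2 : measurable_fun setT h1 -> measurable_fun setT h2 ->
  (forall z, 0 <= h1 z) -> (forall z, 0 <= h2 z) ->
  kint (fun z => h1 z + h2 z) = (kint h1 + kint h2)%E.
Proof.
move=> m1 m2 h10 h20; rewrite /kint -ge0_integralD//.
- by apply: eq_integral => z _; rewrite mulrDl EFinD.
- by move=> z _; rewrite lee_fin mulr_ge0.
- exact: measurable_kint.
- by move=> z _; rewrite lee_fin mulr_ge0.
- exact: measurable_kint.
Qed.

Lemma kintZ (c : R) h : measurable_fun setT h -> (forall z, 0 <= h z) ->
  0 <= c -> kint (fun z => c * h z) = (c%:E * kint h)%E.
Proof.
move=> mh h0 c0; rewrite /kint -ge0_integralZl_EFin//.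
- by apply: eq_integral => z _; rewrite -mulrA EFinM.
- by move=> z _; rewrite lee_fin mulr_ge0.
- exact: measurable_kint.
Qed.

Lemma le_kint h1 h2 : measurable_fun setT h1 -> measurable_fun setT h2 ->
  (forall z, 0 <= h1 z) -> (forall z, h1 z <= h2 z) -> (kint h1 <= kint h2)%E.
Proof.
move=> m1 m2 h10 h12; apply: ge0_le_integral => //.
- by move=> z _; rewrite lee_fin mulr_ge0.
- exact: measurable_kint.
- exact: measurable_kint.
- by move=> z _; rewrite lee_fin ler_wpM2r.
Qed.

Lemma form_ge0 f : (0 <= form f)%E.
Proof. by apply: kint_ge0 => z; exact: sqr_ge0. Qed.

(* The identity
   [v + t psi]^2 + 2 t (Q - dv dpsi) = dv^2 + 2 t Q + t^2 dpsi^2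
   keeps every integrand nonnegative. *)
Lemma euler_lagrange_le D (q : R) v psi Q : measurable D -> 1 < q ->
  measurable_fun setT v -> measurable_fun setT psi -> measurable_fun setT Q ->
  (forall x, 0 <= v x) -> (forall x, 0 <= psi x) -> (forall z, 0 <= Q z) ->
  (forall z, dif v z * dif psi z <= Q z) ->
  (form v < +oo)%E -> (form psi < +oo)%E -> (powint q D v < +oo)%E ->
  (forall t : R, 0 < t ->
    (2^-1%:E * form v - q^-1%:E * powint q D v <=
     2^-1%:E * form (fun x => v x + psi x * t)%R -
     q^-1%:E * powint q D (fun x => v x + psi x * t)%R)%E) ->
  (\int[mu]_(x in D) (v x `^ (q - 1) * psi x)%:E +
   kint (fun z => Q z - dif v z * dif psi z)%R <= kint Q)%E.
Proof.
move=> mD q1 mv mp mQ v0 p0 Q0 Qge fv fp Jv Hmin.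
have q0 : 0 < q by lra.
have mdv := measurable_dif mv; have mdp := measurable_dif mp.
set A := (X in (X + _)%E); set B := (X in (_ + X)%E).
have A0 : (0 <= A)%E by apply: integral_ge0 => x _; rewrite lee_fin mulr_ge0 ?powR_ge0.
have B0 : (0 <= B)%E by apply: kint_ge0 => z; rewrite subr_ge0.
have [->|Qfin] := eqVneq (kint Q) +oo%E; first by rewrite leey.
have Qf : kint Q \is a fin_num by rewrite ge0_fin_numE ?kint_ge0// ltey.
have vf : form v \is a fin_num by rewrite ge0_fin_numE ?form_ge0.
have pf : form psi \is a fin_num by rewrite ge0_fin_numE ?form_ge0.
have Jf : powint q D v \is a fin_num.
  by rewrite ge0_fin_numE// integral_ge0// => x _; rewrite lee_fin powR_ge0.
have mvt t : measurable_fun setT (fun x => v x + psi x * t).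
  by apply: measurable_funD => //; exact: measurable_funM.
have mpow f r : measurable_fun setT f -> measurable_fun D (fun x => (f x `^ r)%:E).
  move=> mf; apply/measurable_EFinP; apply: measurable_funTS.
  exact: (measurableT_comp (measurable_powR r) mf).
have mvp : measurable_fun D (fun x => (v x `^ (q - 1) * psi x)%:E).
  apply/measurable_EFinP; apply: measurable_funTS; apply: measurable_funM => //.
  exact: (measurableT_comp (measurable_powR _) mv).
(* [powR_tangent] integrated with increment [psi x * t]: the first-order gain of the power term
   holds for every [t], without differentiating under the integral. *)
have Jge t : 0 < t -> (powint q D v + (q * t)%:E * A <=
    powint q D (fun x => v x + psi x * t)%R)%E.
  move=> t0; have qt0 : 0 <= q * t by rewrite mulr_ge0 ?ltW.
  have vp0 x : D x -> (0 <= (v x `^ (q - 1) * psi x)%:E)%E.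
    by rewrite lee_fin mulr_ge0 ?powR_ge0.
  have vq0 x : D x -> (0 <= (v x `^ q)%:E)%E by rewrite lee_fin powR_ge0.
  have mtvp : measurable_fun D (fun x => (q * t)%:E * (v x `^ (q - 1) * psi x)%:E)%E.
    exact: measurable_funeM.
  have tvp0 x : D x -> (0 <= (q * t)%:E * (v x `^ (q - 1) * psi x)%:E)%E.
    by move=> Dx; rewrite mule_ge0 ?vp0.
  rewrite /powint -(ge0_integralZl_EFin mu mD vp0 mvp qt0).
  rewrite -(ge0_integralD mu mD vq0 (mpow _ _ mv) tvp0 mtvp).
  apply: ge0_le_integral => //.
  - by move=> x Dx; rewrite adde_ge0 ?vq0 ?tvp0.
  - by apply: emeasurable_funD; [exact: mpow|exact: measurable_funeM].
  - exact: mpow.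
  - move=> x Dx; rewrite -EFinM -EFinD lee_fin.
    apply: le_trans (powR_tangent _ _ q1) => //; last by rewrite mulr_ge0// ltW.
    by rewrite lerD2l le_eqVlt; apply/orP; left; apply/eqP; ring.
have formE t : 0 < t -> (form (fun x => v x + psi x * t)%R + (2 * t)%:E * B =
    form v + (2 * t)%:E * kint Q + (t ^+ 2)%:E * form psi)%E.
  move=> t0; have t2 : 0 <= 2 * t by rewrite mulr_ge0// ltW.
  have mB : measurable_fun setT (fun z => Q z - dif v z * dif psi z).
    by apply: measurable_funB => //; exact: measurable_funM.
  have mdvt := measurable_dif (mvt t).
  have B0' z : 0 <= Q z - dif v z * dif psi z by rewrite subr_ge0.
  have ms2 f : measurable_fun setT (dif f) -> measurable_fun setT (fun z => dif f z ^+ 2).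
    by move=> ?; exact: measurable_funX.
  have mZ c h : measurable_fun setT h -> measurable_fun setT (fun z => c * h z).
    by move=> mh; exact: measurable_funM.
  have s0 f z : 0 <= dif f z ^+ 2 by exact: sqr_ge0.
  have Z0 c h : 0 <= c -> (forall z, 0 <= h z) -> forall z, 0 <= c * h z.
    by move=> c0 h0 z; rewrite mulr_ge0.
  rewrite /B -(kintZ mB B0' t2) -(kintZ mQ Q0 t2) /form.
  rewrite -(kintZ (ms2 _ mdp) (s0 psi) (sqr_ge0 t)).
  rewrite -(kintD (ms2 _ mdvt) (mZ _ _ mB) (s0 _) (Z0 _ _ t2 B0')).
  rewrite -(kintD (ms2 _ mdv) (mZ _ _ mQ) (s0 _) (Z0 _ _ t2 Q0)).
  rewrite -(kintD _ (mZ _ _ (ms2 _ mdp)) _ (Z0 _ _ (sqr_ge0 t) (s0 psi))).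
  - by apply: eq_integral => z _; congr (_ * _)%:E; rewrite /dif; ring.
  - by apply: measurable_funD; [exact: ms2|exact: mZ].
  - by move=> z; rewrite addr_ge0// mulr_ge0.
(* Minimality divided by [t]: what remains beyond the first-order terms is [t / 2] times the finite
   [form psi], which is absorbed by letting [t] tend to 0. *)
have key t : 0 < t -> (A + B <= kint Q + (t / 2 * fine (form psi))%:E)%E.
  move=> t0; have := Jge t t0; have := formE t t0; have := Hmin t t0.
  have := form_ge0 (fun x => v x + psi x * t).
  move: A0 B0; rewrite -(fineK Qf) -(fineK vf) -(fineK pf) -(fineK Jf).
  move: (fine (kint Q)) (fine (form v)) (fine (form psi)) (fine (powint q D v)).
  move: (form (fun x => v x + psi x * t)) (powint q D (fun x => v x + psi x * t)).
  clear Jge formE Hmin; move: A B => A B F J b a p j.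
  have q'0 : 0 < q^-1 by rewrite invr_gt0.
  (* Infinite values are excluded in turn: [F] and [B] by the identity with finite right-hand side,
     [J] by minimality, as the perturbed energy would be [-oo], and [A] by the lower bound on
     [J]. *)
  case: F => [F||] //=; case: B => [B'||] //=; rewrite ?gt0_muley ?lte_fin ?mulr_gt0//.
  case: J => [J||] //=; rewrite ?gt0_muley ?lte_fin//; case: A => [A'||] //=;
    rewrite ?gt0_muley ?lte_fin ?mulr_gt0//=.
  rewrite -!EFinM -!EFinD -?EFinB ?lee_fin.
  move=> A'0 B'0 F0 H1 [H2] H3.
  have H4 : j / q + t * A' <= J / q.
    rewrite -(ler_pM2r q'0) in H3; apply: le_trans H3.
    by rewrite le_eqVlt; apply/orP; left; apply/eqP; field; lra.
  have H5 : t * (A' + B') <= t * (b + t / 2 * p).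
    by rewrite (mulrC (q^-1)) (mulrC (q^-1) J) in H1; nra.
  by rewrite ler_pM2l in H5.
apply/lee_addgt0Pr => e e0.
pose p := fine (form psi).
have p_ge0 : 0 <= p by rewrite fine_ge0 ?form_ge0.
have t0 : 0 < e / (p + 1) by rewrite divr_gt0// ltr_wpDl.
apply: le_trans (key _ t0) _; rewrite leeD2l// lee_fin -/p.
have : e / (p + 1) * p <= e.
  by rewrite mulrAC ler_pdivrMr ?ltr_wpDl// ler_wpM2l ?(ltW e0)// lerDl.
have := mulr_ge0 (ltW t0) p_ge0; set x := e / (p + 1); nra.
Qed.

End quadratic_form.

Lemma cvg_EFin_seq (R : realType) (a : R^nat) (l : R) :
  a @ \oo --> l -> ((a k)%:E @[k --> \oo] --> l%:E)%E.
Proof. by move=> al; apply: cvg_EFin => //; exact: nearW. Qed.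

(** * Passage to the limit from the smooth approximants to the minimiser *)

Section picone_limit.
Context {d : measure_display} {T : measurableType d} {R : realType}.
Variable mu : {sigma_finite_measure set T -> \bar R}.
Variable K : T * T -> R.
Hypotheses (mK : measurable_fun setT K) (K0 : forall z, 0 <= K z).
Local Notation kint := (kint mu K).
Local Notation form := (form mu K).

(** The Lipschitz bound on [psis k] gives the majorant [Q k = Q0 + C * V k ^+ 2], where [Q0] has
    finite integral and does not depend on [k], while the integral of the second term tends to 0.
    Fatou is applied to the power term and to [Q k - dif v * dif (psis k)], after which [Q0] is
    traded for [dif u ^+ 2]. *)
Lemma picone_limit (D : set T) (q C : R) (u v psi : T -> R)
    (phi psis : nat -> T -> R) : measurable D -> 0 <= C ->
  measurable_fun setT u -> measurable_fun setT v -> measurable_fun setT psi ->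
  (forall k, measurable_fun setT (phi k)) ->
  (forall k, measurable_fun setT (psis k)) ->
  (forall x, 0 <= psi x) -> (forall k x, 0 <= psis k x) ->
  (forall k z, `|dif (psis k) z| <= C * (`|dif u z| + `|dif (phi k) z|)) ->
  (forall z, `|dif psi z| <= C * (`|dif u z| + `|dif v z|)) ->
  (forall z, dif v z * dif psi z <= dif u z ^+ 2) ->
  {ae mu, forall x, phi k x @[k --> \oo] --> v x} ->
  {ae mu, forall x, psis k x @[k --> \oo] --> psi x} ->
  (form u < +oo)%E -> (form v < +oo)%E ->
  (form (phi k \- v)%R @[k --> \oo] --> 0)%E ->
  (forall k (Q : T * T -> R), measurable_fun setT Q -> (forall z, 0 <= Q z) ->
    (forall z, dif v z * dif (psis k) z <= Q z) ->
    (\int[mu]_(x in D) (v x `^ (q - 1) * psis k x)%:E +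
     kint (fun z => Q z - dif v z * dif (psis k) z)%R <= kint Q)%E) ->
  (\int[mu]_(x in D) (v x `^ (q - 1) * psi x)%:E +
   kint (fun z => dif u z ^+ 2 - dif v z * dif psi z)%R <= form u)%E.
Proof.
move=> mD C0 mu_ mv mp mphi mpsis p0 ps0 psL pL pic phiv pspsi uoo voo phiv0 EL.
have mdu := measurable_dif mu_; have mdv := measurable_dif mv.
have mdp := measurable_dif mp.
pose V k := dif (phi k \- v).
have mV k : measurable_fun setT (V k).
  by apply: measurable_dif; apply: measurable_funB.
pose Q0 z := C * (`|dif v z| * `|dif u z| + 2 * dif v z ^+ 2).
pose Q k z := Q0 z + C * V k z ^+ 2.
have mabs f : measurable_fun setT (dif f) -> measurable_fun setT (fun z : T * T => `|dif f z|).
  by move=> mf; exact: measurableT_comp.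
have mQ0 : measurable_fun setT Q0.
  apply: measurable_funM => //; apply: measurable_funD.
    by apply: measurable_funM; exact: mabs.
  by apply: measurable_funM => //; exact: measurable_funX.
have mV2 k : measurable_fun setT (fun z => C * V k z ^+ 2).
  by apply: measurable_funM => //; exact: measurable_funX.
have V20 k z : 0 <= C * V k z ^+ 2 by rewrite mulr_ge0 ?sqr_ge0.
have Q00 z : 0 <= Q0 z.
  apply: mulr_ge0 => //; apply: addr_ge0; first exact: mulr_ge0.
  by apply: mulr_ge0 => //; exact: sqr_ge0.
have mQ k : measurable_fun setT (Q k) by exact: measurable_funD.
have Qge0 k z : 0 <= Q k z by rewrite addr_ge0.
(* Read with [a = dif v], [b = dif psi], [c = dif u] and [e] the error [V k], or 0 in the limit. The
   constants come from [|a| |a + e| <= a^2 + |a| |e| <= 2 a^2 + e^2]. *)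
have amgm (a b c e : R) : `|b| <= C * (`|c| + `|a + e|) ->
    a * b <= C * (`|a| * `|c| + 2 * a ^+ 2) + C * e ^+ 2.
  move=> bC; apply: le_trans (ler_norm _) _; rewrite normrM.
  apply: le_trans (ler_wpM2l (normr_ge0 _) bC) _.
  rewrite mulrCA -mulrDr ler_wpM2l// mulrDr -addrA lerD2l.
  have := ler_normD a e; have := real_normK (num_real a); have := real_normK (num_real e).
  have := normr_ge0 a; have := normr_ge0 e; have := sqr_ge0 (`|a| - `|e|).
  move: `|a| `|e| `|a + e| => x y s; nra.
have VE k z : dif (phi k) z = dif v z + V k z by rewrite /V /dif/=; lra.
have Qge k z : dif v z * dif (psis k) z <= Q k z.
  by apply: amgm; rewrite -VE.
have Q0ge z : dif v z * dif psi z <= Q0 z.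
  have := amgm (dif v z) (dif psi z) (dif u z) 0.
  by rewrite addr0 expr0n/= mulr0 addr0; apply.
have Q0oo : kint Q0 \is a fin_num.
  rewrite ge0_fin_numE; last exact: kint_ge0.
  have h1 : measurable_fun setT (fun z => C * dif u z ^+ 2).
    by apply: measurable_funM => //; exact: measurable_funX.
  have h2 : measurable_fun setT (fun z => C * 3 * dif v z ^+ 2).
    by apply: measurable_funM => //; exact: measurable_funX.
  have C30 : 0 <= C * 3 by rewrite mulr_ge0.
  have u20 z : 0 <= dif u z ^+ 2 by exact: sqr_ge0.
  have v20 z : 0 <= dif v z ^+ 2 by exact: sqr_ge0.
  have h10 z : 0 <= C * dif u z ^+ 2 by rewrite mulr_ge0.
  have h20 z : 0 <= C * 3 * dif v z ^+ 2 by rewrite mulr_ge0.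
  have le0 : (kint Q0 <= kint (fun z => C * dif u z ^+ 2 + C * 3 * dif v z ^+ 2)%R)%E.
    apply: le_kint => //; first exact: measurable_funD.
    move=> z; rewrite /Q0 -mulrA -mulrDr ler_wpM2l//.
    have := real_normK (num_real (dif v z)); have := real_normK (num_real (dif u z)).
    have := sqr_ge0 (`|dif v z| - `|dif u z|).
    move: `|dif v z| `|dif u z| => x y; nra.
  apply: le_lt_trans le0 _.
  rewrite kintD// kintZ//; last exact: measurable_funX.
  rewrite kintZ//; last exact: measurable_funX.
  by apply: lte_add_pinfty; apply: lte_mul_pinfty.
have Vform k : form (phi k \- v)%R = kint (fun z => V k z ^+ 2) by [].
have cvgQ : ((kint Q0 + C%:E * form (phi k \- v)%R) @[k --> \oo] --> kint Q0)%E.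
  rewrite -[X in _ --> X]adde0; apply: cvgeD; first exact: fin_num_adde_defr.
    exact: cvg_cst.
  rewrite -[X in _ --> X](mule0 C%:E); apply: cvgeZl => //.
have mvp f : measurable_fun setT f ->
    measurable_fun D (fun x => (v x `^ (q - 1) * f x)%:E).
  move=> mf; apply/measurable_EFinP; apply: measurable_funTS.
  apply: measurable_funM => //.
  exact: (measurableT_comp (measurable_powR _) mv).
have mQd (f : T -> R) (h : T * T -> R) : measurable_fun setT f -> measurable_fun setT h ->
    measurable_fun setT (fun z => ((h z - dif v z * dif f z) * K z)%:E).
  move=> mf mh; apply: measurable_kint => //; apply: measurable_funB => //.
  by apply: measurable_funM => //; exact: measurable_dif.
have lim : (limn_einf (fun k => \int[mu]_(x in D) (v x `^ (q - 1) * psis k x)%:E) +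
    limn_einf (fun k => kint (fun z => Q k z - dif v z * dif (psis k) z)%R) <= kint Q0)%E.
  apply: limn_einfD_le cvgQ.
  - by move=> k; apply: integral_ge0 => x _; rewrite lee_fin mulr_ge0 ?powR_ge0.
  - by move=> k; apply: kint_ge0 => // z; rewrite subr_ge0.
  - move=> k; apply: le_trans (EL k (Q k) (mQ k) (Qge0 k) (Qge k)) _.
    have m2 : measurable_fun setT (fun z => V k z ^+ 2) by exact: measurable_funX.
    have s2 z : 0 <= V k z ^+ 2 by exact: sqr_ge0.
    by rewrite (kintD mu mK K0 mQ0 (mV2 k) Q00 (V20 k)) (kintZ mu mK K0 m2 s2 C0).
have la : (\int[mu]_(x in D) (v x `^ (q - 1) * psi x)%:E <=
    limn_einf (fun k => \int[mu]_(x in D) (v x `^ (q - 1) * psis k x)%:E))%E.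
  apply: ae_fatou => //.
  - by move=> k; exact: mvp.
  - by move=> k x _; rewrite lee_fin mulr_ge0 ?powR_ge0.
  - exact: mvp.
  - by move=> x _; rewrite lee_fin mulr_ge0 ?powR_ge0.
  - apply: filterS pspsi => x px _; left.
    by apply: cvg_EFin_seq; apply: cvgMr.
have lb : (kint (fun z => Q0 z - dif v z * dif psi z)%R <=
    limn_einf (fun k => kint (fun z => Q k z - dif v z * dif (psis k) z)%R))%E.
  apply: ae_fatou => //.
  - by move=> k; exact: mQd.
  - by move=> k z _; rewrite lee_fin mulr_ge0// subr_ge0.
  - exact: mQd.
  - by move=> z _; rewrite lee_fin mulr_ge0// subr_ge0.
  - apply: filterS2 (ae_product phiv) (ae_product pspsi) => z [p1 p2] [s1 s2] _.
    left; apply: cvg_EFin_seq; apply: cvgMl.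
    apply: cvgB; last by apply: cvgMr; apply: cvgB.
    rewrite /Q -[X in _ --> X]addr0; apply: cvgD; first exact: cvg_cst.
    rewrite -[X in _ --> X](mulr0 C); apply: cvgMr.
    have sub0 x : phi k x @[k --> \oo] --> v x -> (phi k x - v x) @[k --> \oo] --> 0.
      by move=> px; rewrite -(subrr (v x)); apply: cvgB => //; exact: cvg_cst.
    have Vz : V k z @[k --> \oo] --> 0.
      by rewrite -(subrr 0); apply: cvgB; exact: sub0.
    by rewrite -[X in _ --> X](mulr0 0); apply: cvgM.
have := le_trans (leeD la lb) lim.
set A := (X in (X + _ <= _)%E) => lim0.
have rem0 z : 0 <= dif u z ^+ 2 - dif v z * dif psi z by rewrite subr_ge0.
have Q0r0 z : 0 <= Q0 z - dif v z * dif psi z by rewrite subr_ge0.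
have mdvp : measurable_fun setT (fun z => dif v z * dif psi z) by exact: measurable_funM.
have mu2 : measurable_fun setT (fun z => dif u z ^+ 2) by exact: measurable_funX.
(* The exchange of majorants: both sides integrate [Q0 + dif u ^+ 2 - dif v * dif psi], grouped into
   nonnegative parts in two ways. Finiteness of [kint Q0] then permits its cancellation. *)
have split : (kint (fun z => Q0 z - dif v z * dif psi z)%R + form u =
    kint Q0 + kint (fun z => dif u z ^+ 2 - dif v z * dif psi z)%R)%E.
  have mQp : measurable_fun setT (fun z => Q0 z - dif v z * dif psi z).
    exact: measurable_funB.
  have mup : measurable_fun setT (fun z => dif u z ^+ 2 - dif v z * dif psi z).
    exact: measurable_funB.
  have u0 z : 0 <= dif u z ^+ 2 by exact: sqr_ge0.
  rewrite -(kintD mu mK K0 mQp mu2 Q0r0 u0) -(kintD mu mK K0 mQ0 mup Q00 rem0).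
  by apply: eq_integral => z _; congr (_ * _)%:E; ring.
by rewrite -(leeD2lE _ _ Q0oo) addeCA -split addeA leeD2r.
Qed.

End picone_limit.

(** * Picone's inequality *)

Section regularised_inverse.
Context {R : realType}.
Implicit Types (e t a b x y : R).

(* A smooth positive substitute for [1 / t] on the whole line, whose reciprocal
   has slope at least 1 on [t >= 0]; the shift by [e] and the factor [1 + e^2]
   serve only that purpose. *)
Definition rinv_den e t : R := (1 + e ^+ 2) * ((t + e) ^+ 2 + e ^+ 4).
Definition rinv e t : R := (Num.sqrt (rinv_den e t))^-1.

Lemma rinv_den_gt0 e t : 0 < e -> 0 < rinv_den e t.
Proof.
move=> e0; apply: mulr_gt0; first by rewrite ltr_pwDl ?sqr_ge0.
by rewrite ltr_wpDl ?sqr_ge0 ?exprn_gt0.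
Qed.

Lemma sqrt_rinv_den_gt0 e t : 0 < e -> 0 < Num.sqrt (rinv_den e t).
Proof. by move=> e0; rewrite sqrtr_gt0 rinv_den_gt0. Qed.

Lemma sqr_sqrt_rinv_den e t : 0 < e -> Num.sqrt (rinv_den e t) ^+ 2 = rinv_den e t.
Proof. by move=> e0; rewrite sqr_sqrtr// ltW// rinv_den_gt0. Qed.

Lemma rinv_gt0 e t : 0 < e -> 0 < rinv e t.
Proof. by move=> e0; rewrite invr_gt0 sqrt_rinv_den_gt0. Qed.

Lemma sqrt_rinv_den_ge e t : 0 < e -> `|t + e| <= Num.sqrt (rinv_den e t).
Proof.
move=> e0; rewrite -sqrtr_sqr ler_wsqrtr// /rinv_den.
have := sqr_ge0 (t + e); have := sqr_ge0 e; have := exprn_ge0 4 (ltW e0).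
move: (_ ^+ 2) (e ^+ 2) (e ^+ 4) => p r s; nra.
Qed.

Lemma rinv_le e t : 0 < e -> rinv e t <= e ^- 2.
Proof.
move=> e0; rewrite lef_pV2 ?posrE ?sqrt_rinv_den_gt0 ?exprn_gt0//.
rewrite -[leLHS]ger0_norm ?sqr_ge0// -sqrtr_sqr ler_wsqrtr// /rinv_den -exprM.
have := sqr_ge0 (t + e); have := sqr_ge0 e; have := exprn_ge0 4 (ltW e0).
move: (_ ^+ 2) (e ^+ 2) (e ^+ (2 * 2)) => p r s; nra.
Qed.

(** For the two square roots [p] and [r], the factorisation of [p^2 - r^2] together with
    [|a + e| <= p] and [|b + e| <= r] gives [|p - r| <= (1 + e^2) |a - b|]. The two factors [e ^- 2]
    bound [1 / p] and [1 / r]. *)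
Lemma rinv_lipschitz e a b : 0 < e ->
  `|rinv e a - rinv e b| <= (1 + e ^+ 2) * e ^- 2 * e ^- 2 * `|a - b|.
Proof.
move=> e0; rewrite /rinv.
have ga := rinv_le a e0; have gb := rinv_le b e0.
have ha := sqrt_rinv_den_gt0 a e0; have hb := sqrt_rinv_den_gt0 b e0.
have E := sqr_sqrt_rinv_den a e0; have F := sqr_sqrt_rinv_den b e0.
have la := sqrt_rinv_den_ge a e0; have lb := sqrt_rinv_den_ge b e0.
have g0a := rinv_gt0 a e0; have g0b := rinv_gt0 b e0.
rewrite /rinv in ga gb g0a g0b.
set p := Num.sqrt _ in ha E la ga g0a *; set r := Num.sqrt _ in hb F lb gb g0b *.
have p0 : p != 0 by rewrite gt_eqF.
have r0 : r != 0 by rewrite gt_eqF.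
have -> : p^-1 - r^-1 = (r - p) * p^-1 * r^-1 by field; apply/andP.
rewrite !normrM (gtr0_norm g0a) (gtr0_norm g0b) (distrC r).
have prL : `|p - r| <= (1 + e ^+ 2) * `|a - b|.
  have pr0 : 0 < p + r by rewrite addr_gt0.
  rewrite -(ler_pM2r pr0) -{1}(gtr0_norm pr0) -normrM -subr_sqr E F.
  have -> : rinv_den e a - rinv_den e b =
      (1 + e ^+ 2) * (a - b) * ((a + e) + (b + e)) by rewrite /rinv_den; ring.
  rewrite !normrM (ger0_norm (addr_ge0 ler01 (sqr_ge0 e))).
  rewrite ler_wpM2l ?mulr_ge0 ?addr_ge0 ?sqr_ge0//.
  exact: le_trans (ler_normD _ _) (lerD la lb).
have -> : (1 + e ^+ 2) * e ^- 2 * e ^- 2 * `|a - b| =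
  (1 + e ^+ 2) * `|a - b| * e ^- 2 * e ^- 2 by ring.
apply: ler_pM => //; [by rewrite mulr_ge0// ltW|exact: ltW|].
by apply: ler_pM => //; exact: ltW.
Qed.

Lemma rinv_slope e a b : 0 < e -> 0 <= b -> b <= a ->
  a - b <= (rinv e a)^-1 - (rinv e b)^-1.
Proof.
move=> e0 b0 ba; rewrite /rinv !invrK lerBrDr -[leRHS]ger0_norm ?sqrtr_ge0//.
have s0 : 0 <= a - b + Num.sqrt (rinv_den e b) by rewrite addr_ge0 ?sqrtr_ge0 ?subr_ge0.
rewrite -ler_sqr ?nnegrE// ?normr_ge0// real_normK ?num_real//.
rewrite (sqr_sqrt_rinv_den a e0) sqrrD (sqr_sqrt_rinv_den b e0).
(* The claim after squaring comes down to this bound, which amounts to [e^4 <= e^2 (b + e)^2]. The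
   shift by [e] makes this true for [b >= 0], and the factor [1 + e^2] provides the [e^2] on the
   right. *)
have hb : Num.sqrt (rinv_den e b) <= (1 + e ^+ 2) * (b + e).
  rewrite -[leRHS]ger0_norm ?mulr_ge0 ?addr_ge0 ?sqr_ge0 ?(ltW e0)//.
  rewrite -sqrtr_sqr ler_wsqrtr// /rinv_den exprMn -subr_ge0.
  have -> : (1 + e ^+ 2) ^+ 2 * (b + e) ^+ 2 - (1 + e ^+ 2) * ((b + e) ^+ 2 + e ^+ 4) =
     (1 + e ^+ 2) * e ^+ 2 * (b ^+ 2 + 2 * b * e) by ring.
  by rewrite !mulr_ge0 ?addr_ge0 ?mulr_ge0 ?sqr_ge0 ?(ltW e0)// mulr_ge0.
have -> : rinv_den e a = rinv_den e b + (1 + e ^+ 2) * (a - b) * (2 * (b + e) + (a - b)).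
  by rewrite /rinv_den; ring.
have ab0 : 0 <= a - b by rewrite subr_ge0.
have := ler_wpM2l ab0 hb; have := sqr_ge0 (a - b); have := sqr_ge0 (e * (a - b)).
move: (Num.sqrt _) => s; nra.
Qed.

(** With [1 / p - 1 / r] in place of [a - b], the difference of the two sides is exactly the square
    [(x p - y r)^2 / (p r)]. By [rinv_slope] the replacement only increases the left side when the
    second factor is positive; otherwise the left side is at most 0. *)
Lemma rinv_picone e a b x y : 0 < e -> 0 <= a -> 0 <= b ->
  (a - b) * (x ^+ 2 * rinv e a - y ^+ 2 * rinv e b) <= (x - y) ^+ 2.
Proof.
move=> e0; wlog ba : a b x y / b <= a.
  move=> H a0 b0; have [ba|/ltW ab] := leP b a; first exact: H.
  have := H b a y x ab b0 a0; rewrite -(opprB x y) sqrrN; congr (_ <= _); ring.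
move=> a0 b0; have := rinv_slope e0 b0 ba.
have := rinv_gt0 a e0; have := rinv_gt0 b e0.
move: (rinv e a) (rinv e b) => p r r0 p0 slope.
have [X0|X0] := leP (x ^+ 2 * p - y ^+ 2 * r) 0.
  by apply: le_trans (sqr_ge0 _); rewrite mulr_ge0_le0 ?subr_ge0.
apply: le_trans (ler_wpM2r (ltW X0) slope) _; rewrite -subr_ge0.
have -> : (x - y) ^+ 2 - (p^-1 - r^-1) * (x ^+ 2 * p - y ^+ 2 * r) =
    (x * p - y * r) ^+ 2 / (p * r) by field; rewrite !gt_eqF.
by rewrite divr_ge0 ?sqr_ge0// mulr_ge0 ?ltW.
Qed.

Lemma rinv_quotient_lipschitz e M x y a b : 0 < e -> `|x| <= M -> `|y| <= M ->
  `|x ^+ 2 * rinv e a - y ^+ 2 * rinv e b| <=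
  (2 * M * e ^- 2 + M ^+ 2 * ((1 + e ^+ 2) * e ^- 2 * e ^- 2)) * (`|x - y| + `|a - b|).
Proof.
move=> e0 xM yM.
have M0 : 0 <= M by exact: le_trans xM.
have e2 : 0 <= e ^- 2 by rewrite invr_ge0 sqr_ge0.
have -> : x ^+ 2 * rinv e a - y ^+ 2 * rinv e b =
    (x - y) * (x + y) * rinv e a + y ^+ 2 * (rinv e a - rinv e b) by ring.
have h1 : `|(x - y) * (x + y) * rinv e a| <= 2 * M * e ^- 2 * `|x - y|.
  rewrite !normrM -mulrA [leRHS]mulrC; apply: ler_wpM2l => //.
  apply: ler_pM => //; first by apply: le_trans (ler_normD _ _) _; lra.
  by rewrite gtr0_norm ?rinv_gt0// rinv_le.
have h2 : `|y ^+ 2 * (rinv e a - rinv e b)| <=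
    M ^+ 2 * ((1 + e ^+ 2) * e ^- 2 * e ^- 2) * `|a - b|.
  rewrite normrM -mulrA; apply: ler_pM => //; last exact: rinv_lipschitz.
  by rewrite normrX ler_pXn2r ?nnegrE.
apply: le_trans (ler_normD _ _) _.
apply: le_trans (lerD h1 h2) _.
have : 0 <= 2 * M * e ^- 2 by rewrite !mulr_ge0.
have : 0 <= M ^+ 2 * ((1 + e ^+ 2) * e ^- 2 * e ^- 2).
  by rewrite !mulr_ge0 ?sqr_ge0// addr_ge0 ?sqr_ge0.
have := normr_ge0 (x - y); have := normr_ge0 (a - b).
move: `|x - y| `|a - b| (2 * M * _) (M ^+ 2 * _) => X Y p r; nra.
Qed.

Lemma continuous_rinv e : 0 < e -> continuous (rinv e).
Proof.
move=> e0 t; rewrite /rinv.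
have cd : {for t, continuous (rinv_den e)}.
  rewrite /rinv_den; apply: cvgMr; apply: cvgD; last exact: cvg_cst.
  by apply: (@continuous_comp _ _ _ (fun t => t + e) (fun t => t ^+ 2));
    [apply: cvgD; [exact: cvg_id|exact: cvg_cst]|exact: exprn_continuous].
have cs : {for t, continuous (Num.sqrt \o rinv_den e)}.
  by apply: continuous_comp => //; exact: sqrt_continuous.
by have := @continuousV _ _ (Num.sqrt \o rinv_den e) t
  (lt0r_neq0 (sqrt_rinv_den_gt0 t e0)) cs.
Qed.

(** At a zero of the minimiser the regularised inverse blows up like [1 / e]; the exact product
    supplies the surviving term in [zero_set_dichotomy]. *)
Lemma rinv0 e : 0 < e -> e * rinv e 0 = (1 + e ^+ 2)^-1.
Proof.
move=> e0; rewrite /rinv /rinv_den add0r.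
have -> : (1 + e ^+ 2) * (e ^+ 2 + e ^+ 4) = ((1 + e ^+ 2) * e) ^+ 2 by ring.
rewrite sqrtr_sqr ger0_norm ?mulr_ge0 ?addr_ge0 ?sqr_ge0 ?(ltW e0)//.
by rewrite invfM mulrCA divff ?mulr1// gt_eqF.
Qed.

Lemma cvg_rinv t (e : R^nat) : 0 < t ->
  e @ \oo --> 0 -> rinv (e k) t @[k --> \oo] --> t^-1.
Proof.
move=> t0 e0; rewrite /rinv; apply: cvgV; first by rewrite gt_eqF.
rewrite [X in _ --> X](_ : t = Num.sqrt ((1 + 0 ^+ 2) * ((t + 0) ^+ 2 + 0 ^+ 4))); last first.
  by rewrite !expr0n/= !addr0 mul1r sqrtr_sqr gtr0_norm.
have cX (a : R^nat) (l : R) n : a @ \oo --> l -> a k ^+ n @[k --> \oo] --> l ^+ n.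
  by move=> al; exact: (continuous_cvg _ (@exprn_continuous R n l) al).
have cd : rinv_den (e k) t @[k --> \oo] --> (1 + 0 ^+ 2) * ((t + 0) ^+ 2 + 0 ^+ 4).
  apply: cvgM; first by apply: cvgD; [exact: cvg_cst|exact: cX].
  by apply: cvgD; apply: cX => //; apply: cvgD => //; exact: cvg_cst.
exact: (continuous_cvg _ (@sqrt_continuous R _) cd).
Qed.

Lemma measurable_rinv e : 0 < e -> measurable_fun setT (rinv e).
Proof. by move=> e0; apply: continuous_measurable_fun; exact: continuous_rinv. Qed.

End regularised_inverse.

Lemma measurable_inve_ge0 (d : measure_display) (T : measurableType d) (R : realType)
    (f : T -> \bar R) : measurable_fun setT f -> (forall x, 0 <= f x)%E ->
  measurable_fun setT (fun x => (f x)^-1)%E.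
Proof.
move=> mf f0.
rewrite (_ : (fun x => _) = (fun x => if f x == 0 then +oo else
    if f x == +oo then 0 else (fine (f x) `^ (- 1))%:E)%E).
  apply: measurable_fun_ifT => //; first exact: measurable_fun_eqe.
  apply: measurable_fun_ifT => //; first exact: measurable_fun_eqe.
  apply/measurable_EFinP.
  apply: (measurableT_comp (measurable_powR (- 1))).
  exact: measurableT_comp.
apply/funext => x; move: (f0 x); case: (f x) => [r||]//= r0.
by rewrite inver eqe; case: ifP => // _; rewrite powR_inv1.
Qed.

(** * The zero set of the minimiser, and the limit [e -> 0] *)

Section zero_set_and_weight.
Context {d : measure_display} {T : measurableType d} {R : realType}.
Variable mu : {sigma_finite_measure set T -> \bar R}.
Variable K : T * T -> R.
Hypotheses (mK : measurable_fun setT K) (K0 : forall z, 0 <= K z).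
Hypothesis K_gt0 : forall x y, x <> y -> 0 < K (x, y).
Local Notation kint := (kint mu K).
Local Notation form := (form mu K).
Variables (D : set T) (q : R) (u v : T -> R).
Hypotheses (mD : measurable D) (q12 : 1 < q < 2).
Hypotheses (mu_ : measurable_fun setT u) (mv : measurable_fun setT v).
Hypotheses (v0 : forall x, 0 <= v x) (uoo : (form u < +oo)%E).
Let psi (e : R) x := u x ^+ 2 * rinv e (v x).
Hypothesis picone_le : forall e, 0 < e ->
  (\int[mu]_(x in D) (v x `^ (q - 1) * psi e x)%:E +
   kint (fun z => dif u z ^+ 2 - dif v z * dif (psi e) z)%R <= form u)%E.

Let ffin : form u \is a fin_num.
Proof. by rewrite ge0_fin_numE// form_ge0. Qed.

Let mpsi e : 0 < e -> measurable_fun setT (psi e).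
Proof.
move=> e0; apply: measurable_funM; first exact: measurable_funX.
exact: (measurableT_comp (measurable_rinv e0) mv).
Qed.

Let rem_ge0 e z : 0 < e -> 0 <= dif u z ^+ 2 - dif v z * dif (psi e) z.
Proof. by move=> e0; rewrite subr_ge0 rinv_picone. Qed.

Let weighted_ge0 e x : 0 < e -> 0 <= v x `^ (q - 1) * psi e x.
Proof.
by move=> e0; rewrite mulr_ge0 ?powR_ge0// mulr_ge0 ?sqr_ge0// ltW// rinv_gt0.
Qed.

Let h0 n : 0 < @harmonic R n. Proof. by rewrite /= invr_gt0. Qed.

(* Multiplied by [e], the Picone remainder at pairs with [v x = 0] tends to
   [u(x)^2 v(y)], whereas [e [u]^2] tends to 0. *)
Lemma zero_set_dichotomy :
  {ae mu, forall x, v x = 0 -> u x = 0} \/ {ae mu, forall x, v x = 0}.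
Proof.
(* The limit of [e] times the remainder where [v z.1 = 0]; it is set to 0 elsewhere, where
   [ae_fatou_le] then asks for no convergence. *)
pose g (z : T * T) : \bar R :=
  (if v z.1 == 0%R then (u z.1 ^+ 2 * v z.2 * K z)%:E else 0)%E.
have mv1 : measurable_fun setT (fun z : T * T => v z.1).
  exact: (measurableT_comp mv measurable_fst).
have mv2 : measurable_fun setT (fun z : T * T => v z.2).
  exact: (measurableT_comp mv measurable_snd).
have mu1 : measurable_fun setT (fun z : T * T => u z.1).
  exact: (measurableT_comp mu_ measurable_fst).
have mg : measurable_fun setT g.
  apply: measurable_fun_ifT => //; first exact: measurable_fun_eqr.
  apply/measurable_EFinP; apply: measurable_funM => //; apply: measurable_funM => //.
  exact: measurable_funX.
have g0 z : (0 <= g z)%E.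
  by rewrite /g; case: ifP => // _; rewrite lee_fin mulr_ge0// mulr_ge0 ?sqr_ge0.
have mrem e : 0 < e ->
    measurable_fun setT (fun z => dif u z ^+ 2 - dif v z * dif (psi e) z).
  move=> e0; apply: measurable_funB.
    by apply: measurable_funX; exact: measurable_dif.
  exact: (measurable_funM (measurable_dif mv) (measurable_dif (mpsi e0))).
have intg : (\int[mu \x mu]_z g z <= 0)%E.
  apply: (@ae_fatou_le _ _ _ (mu \x mu)%E setT
    (fun n z => (harmonic n * (dif u z ^+ 2 - dif v z * dif (psi (harmonic n)) z) * K z)%:E)
    g (fun n => (harmonic n)%:E * form u)%E) => //.
  - move=> n; apply/measurable_EFinP; apply: measurable_funM => //.
    by apply: measurable_funM => //; exact: mrem.
  - move=> n z _; rewrite lee_fin mulr_ge0// mulr_ge0 ?(ltW (h0 n))//.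
    exact: rem_ge0.
  - apply: aeW => z _; rewrite /g.
    have [vz|] := eqVneq (v z.1) 0; last by right.
    left; have ch := @cvg_harmonic R.
    have c1 : harmonic n * dif u z ^+ 2 @[n --> \oo] --> 0 * dif u z ^+ 2.
      exact: cvgMl.
    have c2 : v z.2 * u z.1 ^+ 2 * (1 + harmonic n ^+ 2)^-1 @[n --> \oo] -->
        v z.2 * u z.1 ^+ 2 * (1 + 0 ^+ 2)^-1.
      apply: cvgMr; apply: cvgV; first by rewrite expr0n/= addr0 oner_neq0.
      apply: cvgD; first exact: cvg_cst.
      exact: (continuous_cvg _ (@exprn_continuous R 2 0) ch).
    have c3 : harmonic n * (v z.2 * u z.2 ^+ 2 * rinv (harmonic n) (v z.2))
        @[n --> \oo] --> 0 * (v z.2 * u z.2 ^+ 2 * (v z.2)^-1).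
      (* At [v z.2 = 0] the factor [rinv] is unbounded as [e] tends to 0, but it is multiplied by
         [v z.2], so the sequence is identically 0. *)
      have [v2|v2] := eqVneq (v z.2) 0.
        rewrite !mul0r (_ : (fun n => _) = fun=> 0); first exact: cvg_cst.
        by apply/funext => n; rewrite v2 !mul0r mulr0.
      apply: cvgM => //; apply: cvgMr; apply: cvg_rinv => //.
      by rewrite lt_neqAle eq_sym v2 v0.
    pose f n := harmonic n * (dif u z ^+ 2 - dif v z * dif (psi (harmonic n)) z).
    have cf : f @ \oo --> u z.1 ^+ 2 * v z.2.
      rewrite (_ : f = (fun n => harmonic n * dif u z ^+ 2 +
        v z.2 * u z.1 ^+ 2 * (1 + harmonic n ^+ 2)^-1 -
        harmonic n * (v z.2 * u z.2 ^+ 2 * rinv (harmonic n) (v z.2)))); last first.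
        by apply/funext => n; rewrite -(rinv0 (h0 n)) /f /dif /psi vz; ring.
      rewrite (_ : u z.1 ^+ 2 * v z.2 = 0 * dif u z ^+ 2 +
        v z.2 * u z.1 ^+ 2 * (1 + 0 ^+ 2)^-1 - 0 * (v z.2 * u z.2 ^+ 2 * (v z.2)^-1)).
        by apply: cvgB; [apply: cvgD|].
      by rewrite expr0n/= addr0 invr1 mulr1 !mul0r add0r subr0 mulrC.
    by apply: cvg_EFin_seq; exact: cvgMl cf.
  - move=> n.
    have := picone_le (h0 n); set A := (X in (X + _ <= _)%E) => le1.
    have A0 : (0 <= A)%E.
      by apply: integral_ge0 => x _; rewrite lee_fin weighted_ge0.
    have le2 := le_trans (leeDr _ A0) le1.
    apply: le_trans (lee_wpmul2l _ le2); last by rewrite lee_fin ltW.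
    rewrite -(kintZ mu mK K0 (mrem _ (h0 n)) (fun z => rem_ge0 z (h0 n)) (ltW (h0 n))).
    exact: lexx.
  - rewrite -(fineK ffin).
    rewrite -[X in _ --> X](mul0e (fine (form u))%:E) -EFinM.
    under eq_cvg do rewrite -EFinM.
    by apply: cvg_EFin_seq; apply: cvgMl; exact: cvg_harmonic.
have {intg} : (\int[mu]_x \int[mu]_y g (x, y) = 0)%E.
  apply/eqP; rewrite eq_le; apply/andP; split.
    by apply: le_trans intg; rewrite (fubini_tonelli1 g mg g0).
  by apply: integral_ge0 => x _; apply: integral_ge0.
have gF x : (0 <= \int[mu]_y g (x, y))%E by apply: integral_ge0.
under eq_integral do rewrite -(gee0_abs (gF _)).
move/(ae_eq_integral_abs _ measurableT (measurable_fun_fubini_tonelli_F g mg g0)).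
rewrite /ae_eq => aeg.
have [|nae] := pselect {ae mu, forall x, v x = 0 -> u x = 0}; [by left|right].
(* A single point [x] suffices: vanishing of the inner integral at [x] forces
   [u x ^+ 2 * v y * K (x, y) = 0] for almost every [y], and [u x] is nonzero. *)
have [x [gx vx ux]] : exists x, [/\ (\int[mu]_y g (x, y))%E = 0%E, v x = 0 & u x <> 0].
  apply: contrapT => nex; apply: nae; apply: filterS aeg => x gx vx.
  by apply: contrapT => ux; apply: nex; exists x; split => //; exact: gx.
have mgx : measurable_fun setT (fun y => g (x, y)).
  exact: (measurableT_comp mg (measurable_pair1 x)).
have : (\int[mu]_y `|g (x, y)| = 0)%E.
  by rewrite -[RHS]gx; apply: eq_integral => y _; rewrite gee0_abs.
move/(ae_eq_integral_abs _ measurableT mgx); rewrite /ae_eq.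
apply: filterS => y /(_ I); rewrite /g /= vx eqxx => -[] /eqP.
rewrite mulf_eq0 mulf_eq0 sqrf_eq0 => /orP[/orP[/eqP//|/eqP//]|/eqP Kxy].
(* The kernel may vanish on the diagonal, but there [v y = v x = 0] already. *)
apply: contrapT => vy.
have xy : x <> y by move=> xy; apply: vy; rewrite -xy.
by have := K_gt0 xy; rewrite Kxy ltxx.
Qed.

Lemma weighted_le_form : {ae mu, forall x, v x = 0 -> u x = 0} ->
  (\int[mu]_(x in D) ((u x ^+ 2)%:E / ((v x)%:E `^ (2 - q))) <= form u)%E.
Proof.
move=> vu; have /andP[q1 q2] := q12.
apply: (@ae_fatou_le _ _ _ mu D
    (fun n x => (v x `^ (q - 1) * psi (harmonic n) x)%:E) _ (fun=> form u)) => //.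
- move=> n; apply/measurable_EFinP; apply: measurable_funTS.
  apply: measurable_funM; last exact: mpsi.
  exact: (measurableT_comp (measurable_powR _) mv).
- by move=> n x _; rewrite lee_fin weighted_ge0.
- apply: measurable_funTS; apply: emeasurable_funM.
    by apply/measurable_EFinP; exact: measurable_funX.
  apply: measurable_inve_ge0 => [|x]; last exact: poweR_ge0.
  apply: (measurableT_comp (measurable_poweR (2 - q))).
  exact/measurable_EFinP.
- by move=> x _; rewrite mule_ge0 ?lee_fin ?sqr_ge0// inve_ge0 poweR_ge0.
- apply: filterS vu => x vu _.
  have [vx|vx] := eqVneq (v x) 0.
    (* The inverse of the zero weight is [+oo], and [0 * +oo = 0] makes the integrand vanish,
       because [u x = 0] here. *)
    by right; rewrite vu// expr0n/= mul0e.
  left; have vx0 : 0 < v x by rewrite lt_neqAle eq_sym vx v0.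
  rewrite poweR_EFin inver gt_eqF ?powR_gt0// -EFinM.
  apply: cvg_EFin_seq.
  rewrite [X in _ --> X](_ : _ = v x `^ (q - 1) * (u x ^+ 2 * (v x)^-1)).
    by apply: cvgMr; apply: cvgMr; apply: cvg_rinv => //; exact: cvg_harmonic.
  rewrite mulrCA; congr (_ * _); rewrite -powRN -powR_inv1 ?(ltW vx0)//.
  by rewrite -powRD ?vx ?implybT//; congr (_ `^ _); lra.
- move=> n; apply: le_trans (picone_le (h0 n)).
  rewrite leeDl//; apply: kint_ge0 => // z; exact: rem_ge0.
- exact: cvg_cst.
Qed.

End zero_set_and_weight.

(** * The Gagliardo form on row vectors *)

Section gagliardo_form.
Context {R : realType} {n : nat}.
Local Notation E := 'rV[R]_n.
Local Notation leb := (@lebesgue_rV R n).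
Implicit Types (s q : R) (D : set E) (f u v : E -> R).

Definition frac_kernel s (z : E * E) : R :=
  (enorm (z.1 - z.2) `^ (n%:R + 2 * s))^-1.

Local Notation fform s := (form leb (frac_kernel s)).

Lemma measurable_sqrtr : measurable_fun setT (@Num.sqrt R).
Proof. by apply: continuous_measurable_fun; exact: sqrt_continuous. Qed.

Lemma measurable_enorm : measurable_fun setT (@enorm R n).
Proof.
apply: (measurableT_comp measurable_sqrtr).
apply: measurable_sum => i; apply: measurable_funX; exact: measurable_rV_coord.
Qed.

Lemma measurable_eball (r : R) : measurable (@eball R n r).
Proof.
have := measurable_enorm measurableT (measurable_itv `]-oo, r[).
by rewrite setTI.
Qed.

Lemma measurable_frac_kernel s : measurable_fun setT (frac_kernel s).
Proof.
rewrite (_ : frac_kernel s = fun z => Num.sqrt (\sum_(i < n)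
    (z.1 ord0 i - z.2 ord0 i) ^+ 2) `^ (- (n%:R + 2 * s))).
  apply: (measurableT_comp (measurable_powR _)).
  apply: (measurableT_comp measurable_sqrtr).
  apply: measurable_sum => i; apply: measurable_funX; apply: measurable_funB.
    exact: (measurableT_comp (measurable_rV_coord i) measurable_fst).
  exact: (measurableT_comp (measurable_rV_coord i) measurable_snd).
apply/funext => z; rewrite powRN /frac_kernel /enorm; congr (_ `^ _)^-1.
by congr Num.sqrt; apply: eq_bigr => i _; rewrite !mxE.
Qed.

Lemma frac_kernel_ge0 s z : 0 <= frac_kernel s z.
Proof. by rewrite invr_ge0 powR_ge0. Qed.

Lemma enorm_gt0 (x : E) : x <> 0 -> 0 < enorm x.
Proof.
move=> x0; rewrite sqrtr_gt0 lt_neqAle sumr_ge0 ?andbT; last first.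
  by move=> i _; exact: sqr_ge0.
rewrite eq_sym; apply/negP => /eqP S0; apply: x0.
apply/rowP => i; rewrite mxE; apply/eqP; rewrite -sqrf_eq0 -(rwP eqP).
by have := psumr_eq0P (fun i _ => sqr_ge0 (x ord0 i)) S0; apply.
Qed.

Lemma frac_kernel_gt0 s (x y : E) : x <> y -> 0 < frac_kernel s (x, y).
Proof.
move=> xy; rewrite invr_gt0 powR_gt0// enorm_gt0//= => /eqP.
by rewrite subr_eq0 => /eqP.
Qed.

(** Tonelli: over the product measure the null-set and Fatou arguments apply in both variables at
    once. *)
Lemma gagliardo2E s f : measurable_fun setT f -> gagliardo2 s f = fform s f.
Proof.
move=> mf; rewrite /form /kint fubini_tonelli1//.
- apply: measurable_kint; first exact: measurable_frac_kernel.
  by apply: measurable_funX; exact: measurable_dif.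
- by move=> z; rewrite lee_fin mulr_ge0 ?sqr_ge0 ?frac_kernel_ge0.
Qed.

Lemma eq_ae_form s f g : measurable_fun setT f -> measurable_fun setT g ->
  {ae leb, forall x, f x = g x} -> fform s f = fform s g.
Proof.
move=> mf mg fg; apply: ge0_ae_eq_integral => //.
- apply: measurable_kint; first exact: measurable_frac_kernel.
  by apply: measurable_funX; exact: measurable_dif.
- apply: measurable_kint; first exact: measurable_frac_kernel.
  by apply: measurable_funX; exact: measurable_dif.
- by move=> z _; rewrite lee_fin mulr_ge0 ?sqr_ge0 ?frac_kernel_ge0.
- by move=> z _; rewrite lee_fin mulr_ge0 ?sqr_ge0 ?frac_kernel_ge0.
- by apply: filterS (ae_product fg) => z [e1 e2] _; rewrite /dif e1 e2.
Qed.

Lemma form_lipschitz_lty s (C : R) f g h :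
  measurable_fun setT f -> measurable_fun setT g -> measurable_fun setT h ->
  0 <= C -> (forall z, `|dif f z| <= C * (`|dif g z| + `|dif h z|)) ->
  (fform s g < +oo)%E -> (fform s h < +oo)%E -> (fform s f < +oo)%E.
Proof.
move=> mf mg mh C0 fgh goo hoo.
have mK := measurable_frac_kernel s; have K0 := @frac_kernel_ge0 s.
have m2 (a : E -> R) : measurable_fun setT a -> measurable_fun setT (fun z => dif a z ^+ 2).
  by move=> ma; apply: measurable_funX; exact: measurable_dif.
(* The constant comes from [(y + t)^2 <= 2 y^2 + 2 t^2]. *)
have C20 : 0 <= 2 * C ^+ 2 by rewrite mulr_ge0 ?sqr_ge0.
have s0 (a : E -> R) (z : E * E) : 0 <= dif a z ^+ 2 := sqr_ge0 _.
have mC (a : E -> R) : measurable_fun setT a ->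
    measurable_fun setT (fun z => 2 * C ^+ 2 * dif a z ^+ 2).
  by move=> ma; apply: measurable_funM => //; exact: m2.
have sC a z : 0 <= 2 * C ^+ 2 * dif a z ^+ 2 := mulr_ge0 C20 (s0 a z).
have le1 := le_kint leb mK K0 (m2 _ mf)
  (measurable_funD (mC _ mg) (mC _ mh)) (s0 f).
apply: (le_lt_trans (le1 _)).
  move=> z /=; rewrite -(real_normK (num_real (dif f z))).
  rewrite -(real_normK (num_real (dif g z))) -(real_normK (num_real (dif h z))).
  have := fgh z; have := normr_ge0 (dif f z).
  move: `|dif f z| `|dif g z| `|dif h z| => x y t x0 xC.
  have : x ^+ 2 <= (C * (y + t)) ^+ 2.
    by rewrite ler_pXn2r ?nnegrE// (le_trans x0).
  have := mulr_ge0 (sqr_ge0 C) (sqr_ge0 (y - t)); nra.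
rewrite (kintD leb mK K0 (mC _ mg) (mC _ mh) (sC g) (sC h)).
rewrite (kintZ leb mK K0 (m2 _ mg) (s0 g) C20) (kintZ leb mK K0 (m2 _ mh) (s0 h) C20).
have C2e : (0 <= (2 * C ^+ 2)%:E)%E by rewrite lee_fin.
have C2f : (2 * C ^+ 2)%:E \is a fin_num by [].
apply: lte_add_pinfty; first exact: (lte_mul_pinfty C2e C2f goo).
exact: (lte_mul_pinfty C2e C2f hoo).
Qed.

Lemma energyE s q D v : measurable_fun setT v -> energy s q D v =
  (2^-1%:E * fform s v - q^-1%:E * powint leb q D v)%E.
Proof. by move=> mv; rewrite /energy gagliardo2E. Qed.

Lemma test_function_measurable D f : test_function D f -> measurable_fun setT f.
Proof.
by move=> [sf _ _]; apply: continuous_measurable_rV; exact: smooth_continuous.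
Qed.

Lemma measurable_abs_powR q f : measurable_fun setT f ->
  measurable_fun setT (fun x => (`|f x| `^ q)%:E).
Proof.
move=> mf; apply/measurable_EFinP; apply: (measurableT_comp (measurable_powR q)).
exact: measurableT_comp.
Qed.

Lemma measurable_powint q D f : measurable_fun setT f ->
  measurable_fun D (fun x => (f x `^ q)%:E).
Proof.
move=> mf; apply/measurable_EFinP; apply: measurable_funTS.
exact: (measurableT_comp (measurable_powR q) mf).
Qed.

Lemma eq_ae_powint q D f g : measurable D ->
  measurable_fun setT f -> measurable_fun setT g ->
  {ae leb, forall x, f x = g x} -> powint leb q D f = powint leb q D g.
Proof.
move=> mD mf mg fg; apply: ge0_ae_eq_integral => //.
- exact: measurable_powint.
- exact: measurable_powint.
- by move=> x _; rewrite lee_fin powR_ge0.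
- by move=> x _; rewrite lee_fin powR_ge0.
- by apply: filterS fg => x -> _.
Qed.

Lemma energy_minimizer_ae_eq s q D v v' : measurable D ->
  measurable_fun setT v' -> {ae leb, forall x, v x = v' x} ->
  energy_minimizer s q D v -> energy_minimizer s q D v'.
Proof.
move=> mD mv' vv' [[[mv vD [phi [tphi cphi lphi]]] v0] vmin]; split.
  split; last by apply: filterS2 vv' v0 => x ->.
  split; [exact: mv'|by apply: filterS2 vv' vD => x ->|].
  exists phi; split; [exact: tphi|exact: cphi|].
  have LE k : Lq_powint q D (phi k \- v') = Lq_powint q D (phi k \- v).
    have mk := test_function_measurable (tphi k).
    apply: ge0_ae_eq_integral => //.
    - by apply: measurable_funTS; apply: measurable_abs_powR; exact: measurable_funB.
    - by apply: measurable_funTS; apply: measurable_abs_powR; exact: measurable_funB.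
    - apply: (filterS _ vv') => x vx _; rewrite /= vx //.
  by rewrite (funext LE).
have Ev : energy s q D v' = energy s q D v.
  rewrite (energyE s q D mv) (energyE s q D mv').
  by rewrite (eq_ae_form s mv mv' vv') (eq_ae_powint q mD mv mv' vv').
by move=> psi psiadm; rewrite Ev; exact: vmin.
Qed.

(** Truncation at 0 and restriction to [D] change the minimiser on a null set only. Afterwards sign
    and support conditions hold at every point, as Picone's inequality and the nonnegative
    integrands require. *)
Lemma energy_minimizer_nonneg s q D v : measurable D -> energy_minimizer s q D v ->
  exists v', [/\ energy_minimizer s q D v', measurable_fun setT v',
    forall x, 0 <= v' x, forall x, ~ D x -> v' x = 0 &
    {ae leb, forall x, v x = v' x}].
Proof.
move=> mD vmin; have [[[mv vD _] v0] _] := vmin.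
pose v' x := if x \in D then Num.max (v x) 0 else 0.
have mv' : measurable_fun setT v'.
  apply: measurable_fun_ifT => //; last exact: measurable_maxr.
  apply: (measurable_fun_bool true); rewrite setTI.
  rewrite (_ : _ @^-1` _ = D)//.
  by apply/seteqP; split => x; [exact: set_mem|exact: mem_set].
have vv' : {ae leb, forall x, v x = v' x}.
  apply: filterS2 vD v0 => x vD v0; rewrite /v'; case: ifPn => [|/negP].
    by move=> /set_mem/v0 vx; rewrite max_l.
  by move=> xD; apply: vD => /mem_set.
exists v'; split.
- exact: energy_minimizer_ae_eq vmin.
- exact: mv'.
- by move=> x; rewrite /v'; case: ifP => // _; rewrite le_max lexx orbT.
- by move=> x Dx; rewrite /v' memNset.
- exact: vv'.
Qed.

End gagliardo_form.

(** * Finiteness, admissible perturbations and approximation of a minimiser *)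

Section minimizer.
Context {R : realType} {n : nat}.
Local Notation E := 'rV[R]_n.
Local Notation leb := (@lebesgue_rV R n).
Variables (s q : R) (D : set E) (v : E -> R).
Hypotheses (q12 : 1 < q < 2) (mD : measurable D).
Hypotheses (vmin : energy_minimizer s q D v) (mv : measurable_fun setT v).
Hypotheses (v0 : forall x, 0 <= v x) (vD : forall x, ~ D x -> v x = 0).
Local Notation K := (@frac_kernel R n s).
Local Notation fform := (form leb K).
Local Notation mK := (@measurable_frac_kernel R n s).
Local Notation K0 := (@frac_kernel_ge0 R n s).

Let q0 : 0 < q. Proof. by have /andP[? _] := q12; lra. Qed.

Lemma test_function_Lq_lty (f : E -> R) : test_function D f ->
  (Lq_powint q D f < +oo)%E.
Proof.
move=> tf; have [M M0 fM] := test_function_bounded tf.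
have [B B0 fB] := test_function_supp_bounded tf.
pose I : set R := `[- B, B]%classic.
pose box := [set x : E | forall i, I (x ord0 i)].
have boxE : leb box = (\prod_(i < n) lebesgue_measure I)%E.
  by apply: (@lebesgue_rV_box R n (fun=> I)) => i; exact: measurable_itv.
have mbox : measurable box.
  rewrite (_ : box = \bigcap_(i in [set: 'I_n]) (rV_coord i @^-1` I)).
    apply: fin_bigcap_measurable => [|i _]; first exact: finite_finset.
    rewrite -[X in measurable X]setTI; apply: measurable_rV_coord => //.
    exact: measurable_itv.
  by apply/seteqP; split=> x /= H i; [move=> _; exact: H|exact: (H i)].
have mf := test_function_measurable tf.
have MB x : (`|f x| `^ q)%:E = ((`|f x| `^ q)%:E * (\1_box x)%:E)%E.
  have [->|fx] := eqVneq (f x) 0.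
    by rewrite normr0 powR0 ?mul0e// gt_eqF.
  have sx : supp f x by exact: subset_closure.
  rewrite indicE mem_set ?mule1// => i /=.
  by rewrite /I/= in_itv/= -ler_norml; exact: fB.
apply: (@le_lt_trans _ _ (\int[leb]_(x in D) ((M `^ q)%:E * (\1_box x)%:E))%E).
  apply: ge0_le_integral => //.
  - by apply: measurable_funTS; exact: measurable_abs_powR.
  - apply: measurable_funTS; apply: measurable_funeM.
    by apply/measurable_EFinP; exact: measurable_indic.
  - move=> x _; rewrite MB; apply: lee_wpmul2r; first by rewrite lee_fin.
    by rewrite lee_fin ge0_ler_powR ?nnegrE// ltW.
have i0 x : D x -> (0 <= (\1_box x)%:E :> \bar R)%E by rewrite lee_fin.
have mi : measurable_fun D (fun x => (\1_box x)%:E : \bar R).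
  by apply: measurable_funTS; apply/measurable_EFinP; exact: measurable_indic.
rewrite (ge0_integralZl_EFin leb mD i0 mi (powR_ge0 M q)).
rewrite integral_indic//; apply: lte_mul_pinfty => //.
  by rewrite lee_fin powR_ge0.
apply: (@le_lt_trans _ _ (leb box)).
  by apply: le_measure; rewrite ?inE//; exact: measurableI.
suff : leb box \is a fin_num by move=> ?; rewrite ltey_eq; apply/orP; left.
rewrite boxE; elim/big_ind : _ => //; first by move=> x y; exact: fin_numM.
by move=> i _; rewrite lebesgue_measure_itv/=; case: ifP.
Qed.

(** [D0s2] records only distances to test functions. One finite distance, to some [phi k], is
    enough, through [(a + b)^q <= 2^q (a^q + b^q)]. *)
Lemma minimizer_powint_lty : (powint leb q D v < +oo)%E.
Proof.
have [[[_ _ [phi [tphi _ /fine_cvgP[[k _ /(_ _ (leqnn k)) kfin] _]]]] _] _] := vmin.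
have mk := test_function_measurable (tphi k).
have koo : (Lq_powint q D (phi k \- v)%R < +oo)%E by rewrite ltey_eq kfin.
have mpk : measurable_fun D (fun x => (`|phi k x| `^ q)%:E).
  by apply: measurable_funTS; exact: measurable_abs_powR.
have mpv : measurable_fun D (fun x => (`|(phi k \- v)%R x| `^ q)%:E).
  by apply: measurable_funTS; apply: measurable_abs_powR; exact: measurable_funB.
have p10 x : D x -> (0 <= (`|phi k x| `^ q)%:E)%E by rewrite lee_fin powR_ge0.
have p20 x : D x -> (0 <= (`|(phi k \- v)%R x| `^ q)%:E)%E by rewrite lee_fin powR_ge0.
have p30 x : D x -> (0 <= (`|phi k x| `^ q)%:E + (`|(phi k \- v)%R x| `^ q)%:E)%E.
  by move=> Dx; rewrite adde_ge0 ?p10 ?p20.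
have mp3 : measurable_fun D
    (fun x => (`|phi k x| `^ q)%:E + (`|(phi k \- v)%R x| `^ q)%:E)%E.
  exact: emeasurable_funD.
apply: (@le_lt_trans _ _ (\int[leb]_(x in D) ((2 `^ q)%:E *
    ((`|phi k x| `^ q)%:E + (`|(phi k \- v)%R x| `^ q)%:E)))%E).
  apply: ge0_le_integral => //.
  - by move=> x _; rewrite lee_fin powR_ge0.
  - exact: measurable_powint.
  - exact: measurable_funeM.
  - move=> x _; rewrite -EFinD -EFinM lee_fin.
    have le2 : v x <= 2 * Num.max `|phi k x| `|(phi k \- v)%R x|.
      have : v x <= `|phi k x| + `|(phi k \- v)%R x|.
        rewrite -[leLHS]ger0_norm// (le_trans _ (ler_normB _ _))//=.
        by rewrite le_eqVlt; apply/orP; left; apply/eqP; congr `|_|; lra.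
      move: `|phi k x| `|(phi k \- v)%R x| => a b.
      by rewrite /Num.max; case: ltP; lra.
    have q0' := ltW q0.
    apply: le_trans (ge0_ler_powR q0' _ _ le2) _; rewrite ?nnegrE//.
    rewrite powRM ?le_max ?normr_ge0// ler_wpM2l ?powR_ge0//.
    by rewrite /Num.max; case: ifP => _; rewrite ?lerDl ?lerDr powR_ge0.
rewrite (ge0_integralZl_EFin leb mD p30 mp3 (powR_ge0 2 q)).
rewrite (ge0_integralD leb mD p10 mpk p20 mpv).
apply: lte_mul_pinfty => //.
by apply: lte_add_pinfty; [exact: test_function_Lq_lty|exact: koo].
Qed.

Lemma Lq_powint0 (f : E -> R) : (forall x, f x = 0) -> Lq_powint q D f = 0%E.
Proof.
by move=> f0; apply: integral0_eq => x _; rewrite f0 normr0 powR0// gt_eqF.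
Qed.

Lemma form0 (f : E -> R) : (forall x, f x = 0) -> fform f = 0%E.
Proof.
by move=> f0; apply: integral0_eq => z _; rewrite /dif !f0 subrr expr0n/= mul0r.
Qed.

Lemma test_function_admissible (f : E -> R) : test_function D f ->
  (forall x, 0 <= f x) -> admissible s q D f.
Proof.
move=> tf f0; have mf := test_function_measurable tf; split; last first.
  by apply: aeW => x _; exact: f0.
split; [exact: mf|by apply: aeW => x; exact: test_function_out|].
have z0 x : (f \- f) x = 0 by rewrite /= subrr.
exists (fun=> f); split; first by [].
  move=> e e0; exists 0 => _ _ _ _; rewrite gagliardo2E ?form0 ?lte_fin//.
  exact: measurable_funB.
by rewrite (Lq_powint0 z0); exact: cvg_cst.
Qed.

Lemma minimizer_add_admissible (f : E -> R) (t : R) : test_function D f ->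
  (forall x, 0 <= f x) -> 0 <= t -> admissible s q D (fun x => v x + f x * t).
Proof.
move=> tf f0 t0; have [[[_ _ [phi [tphi cphi lphi]]] _] _] := vmin.
have tft := test_functionZ t tf.
have mft := test_function_measurable tft.
split; last by apply: aeW => x _; rewrite addr_ge0// mulr_ge0.
split; first exact: measurable_funD.
  by apply: aeW => x Dx; rewrite vD// (test_function_out tf Dx) mul0r addr0.
exists (fun k x => phi k x + f x * t); split.
- by move=> k; exact: (test_functionD (tphi k) tft).
- move=> e e0; have [N NP] := cphi e e0; exists N => i j Ni Nj.
  rewrite (_ : _ \- _ = phi i \- phi j); first exact: NP.
  by apply/funext => x /=; lra.
- have LE k : Lq_powint q D ((fun x => phi k x + f x * t) \- (fun x => v x + f x * t)) =
      Lq_powint q D (phi k \- v)%R.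
    by congr Lq_powint; apply/funext => x /=; lra.
  by rewrite (funext LE).
Qed.

(** One competitor of finite seminorm bounds the energy of [v] from above; as the power term of [v]
    is finite, its seminorm must be finite too. *)
Lemma minimizer_form_lty (f : E -> R) : test_function D f ->
  (forall x, 0 <= f x) -> (fform f < +oo)%E -> (fform v < +oo)%E.
Proof.
move=> tf f0 foo; have mf := test_function_measurable tf.
have := vmin.2 f (test_function_admissible tf f0).
rewrite (energyE s q D mv) (energyE s q D mf).
have F0 : (0 <= fform f)%E := form_ge0 _ K0 _.
have V0 : (0 <= fform v)%E := form_ge0 _ K0 _.
have Joo := minimizer_powint_lty.
have J0 : (0 <= powint leb q D v)%E.
  by apply: integral_ge0 => x _; rewrite lee_fin powR_ge0.
have I0 : (0 <= powint leb q D f)%E.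
  by apply: integral_ge0 => x _; rewrite lee_fin powR_ge0.
move: F0 foo V0 Joo J0 I0.
have q'0 : 0 < q^-1 by rewrite invr_gt0.
case: (fform f) => [a||]//; case: (fform v) => [b||]//; first by move=> *; exact: ltry.
case: (powint leb q D v) => [j||]//; case: (powint leb q D f) => [i||]//.
  by rewrite -!EFinM gt0_muley ?lte_fin.
by rewrite -!EFinM !gt0_muley ?lte_fin.
Qed.

(** The definition of the completion does not say that the approximants converge to [v] in the
    seminorm. An almost everywhere convergent subsequence and Fatou's lemma, applied in the second
    index of the Cauchy condition, give it. *)
Lemma minimizer_approx :
  exists phi : nat -> E -> R, [/\ forall k, test_function D (phi k),
    {ae leb, forall x, phi k x @[k --> \oo] --> v x},
    forall k, (fform (phi k \- v)%R < +oo)%E &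
    (fform (phi k \- v)%R @[k --> \oo] --> 0)%E].
Proof.
have [[[_ _ [phi [tphi cphi lphi]]] _] _] := vmin.
have mk k := test_function_measurable (tphi k).
have [||j jk jv] := cvg_integral0_ae_subseq mD _ _ lphi.
- by move=> k; apply: measurable_funTS; apply: measurable_abs_powR; exact: measurable_funB.
- by move=> k x _; rewrite lee_fin powR_ge0.
have aev : {ae leb, forall x, phi (j k) x @[k --> \oo] --> v x}.
  apply: (filterS _ jv) => x jx; have [Dx|Dx] := pselect (D x); last first.
    rewrite vD// (_ : (fun k => _) = fun=> 0); first exact: cvg_cst.
    by apply/funext => k; exact: test_function_out (tphi _) Dx.
  apply/cvgrPdist_lt => e e0.
  have /fine_cvgP[_ /cvgrPdist_lt/(_ _ (powR_gt0 q e0))] := jx Dx.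
  apply: filterS => k /=; rewrite sub0r normrN ger0_norm ?powR_ge0//.
  rewrite distrC => lt; rewrite ltNge; apply/negP => le.
  by move: lt; rewrite ltNge ge0_ler_powR ?nnegrE// ltW.
(* The second index runs along [j (m + k)], which is at least [k] for every [m], so the Cauchy bound
   is available from the first term on. *)
have formle k (e : R) : (forall i, (k <= i)%N ->
    (gagliardo2 s (phi k \- phi i)%R < e%:E)%E) -> (fform (phi k \- v)%R <= e%:E)%E.
  move=> ke; have mform g : measurable_fun setT g ->
      measurable_fun setT (fun z => (dif g z ^+ 2 * K z)%:E).
    move=> mg; apply: measurable_kint; first exact: mK.
    by apply: measurable_funX; exact: measurable_dif.
  apply: (@ae_fatou_le _ _ _ (leb \x leb)%E setT
    (fun m z => (dif (phi k \- phi (j (m + k)%N)) z ^+ 2 * K z)%:E)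
    _ (fun=> e%:E)) => //.
  - by move=> m; apply: mform; exact: measurable_funB.
  - by move=> m z _; rewrite lee_fin mulr_ge0 ?sqr_ge0 ?K0.
  - by apply: mform; exact: measurable_funB.
  - by move=> z _; rewrite lee_fin mulr_ge0 ?sqr_ge0 ?K0.
  - apply: (filterS _ (ae_product aev)) => z [z1 z2] _; left.
    apply: cvg_EFin_seq; apply: cvgMl.
    have sh x : phi (j i) x @[i --> \oo] --> v x ->
        phi (j (m + k)%N) x @[m --> \oo] --> v x.
      by rewrite (cvg_shiftn k (fun i => phi (j i) x)).
    have cd : dif (phi k \- phi (j (m + k)%N)) z @[m --> \oo] --> dif (phi k \- v) z.
      apply: cvgB; apply: cvgB; try exact: cvg_cst; exact: sh.
    exact: (continuous_cvg _ (@exprn_continuous R 2 _) cd).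
  - move=> m; rewrite -[leLHS]/(fform (phi k \- phi (j (m + k)%N))%R).
    rewrite -gagliardo2E; last exact: measurable_funB.
    by apply: ltW; apply: ke; apply: leq_trans (jk _); exact: leq_addl.
  - exact: cvg_cst.
have cvg0 : (fform (phi (j k) \- v)%R @[k --> \oo] --> 0)%E.
  apply/fine_cvgP; split.
    have [N NP] := cphi 1 ltr01; exists N => // k /= Nk.
    rewrite ge0_fin_numE ?form_ge0//; last exact: K0.
    apply: le_lt_trans (ltry 1); apply: formle => i ki.
    by apply: NP; [exact: leq_trans Nk (jk k)|exact: leq_trans (leq_trans Nk (jk k)) ki].
  apply/cvgrPdist_le => e e0; have [N NP] := cphi e e0; exists N => // k /= Nk.
  rewrite sub0r normrN ger0_norm ?fine_ge0 ?form_ge0//; last exact: K0.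
  have : (fform (phi (j k) \- v)%R <= e%:E)%E.
    apply: formle => i ki.
    by apply: NP; [exact: leq_trans Nk (jk k)|exact: leq_trans (leq_trans Nk (jk k)) ki].
  have := form_ge0 leb K0 (phi (j k) \- v).
  by case: (fform (phi (j k) \- v)%R) => [r||]//=; rewrite !lee_fin.
(* Convergence to 0 gives finite values only eventually; dropping the first [N] terms makes all of
   them finite. *)
have /fine_cvgP[[N _ NP] _] := cvg0.
exists (fun k => phi (j (k + N)%N)); split.
- by move=> k; exact: tphi.
- by apply: filterS aev => x; rewrite (cvg_shiftn N (fun i => phi (j i) x)).
- by move=> k; rewrite ltey_eq NP//= leq_addl.
- by rewrite (cvg_shiftn N (fun k => fform (phi (j k) \- v)%R)).
Qed.

End minimizer.

(** * The weighted inequality for a minimiser *)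

Section minimizer_weight.
Context {R : realType} {n : nat}.
Local Notation E := 'rV[R]_n.
Local Notation leb := (@lebesgue_rV R n).
Variables (s q : R) (D : set E) (v u : E -> R).
Hypotheses (q12 : 1 < q < 2) (mD : measurable D).
Hypotheses (vmin : energy_minimizer s q D v) (mv : measurable_fun setT v).
Hypotheses (v0 : forall x, 0 <= v x) (vD : forall x, ~ D x -> v x = 0).
Hypotheses (tu : test_function D u).
Local Notation K := (@frac_kernel R n s).
Local Notation fform := (form leb K).
Local Notation mK := (@measurable_frac_kernel R n s).
Local Notation K0 := (@frac_kernel_ge0 R n s).
Hypothesis uoo : (fform u < +oo)%E.

Let q0 : 0 < q. Proof. by have /andP[? _] := q12; lra. Qed.

(** A nonnegative competitor, since [u] itself may change sign. *)
Let usqr x := u x ^+ 2.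

Let tu2 : test_function D usqr.
Proof.
rewrite (_ : usqr = u * u); last by apply/funext => x; rewrite /usqr expr2.
by apply: test_functionMl => //; have [] := tu.
Qed.

Let usqr_ge0 x : 0 <= usqr x. Proof. exact: sqr_ge0. Qed.

Let mu_ := test_function_measurable tu.

Let usqr_lty : (fform usqr < +oo)%E.
Proof.
have [M M0 uM] := test_function_bounded tu.
have M20 : 0 <= 2 * M by lra.
apply: (form_lipschitz_lty (test_function_measurable tu2) mu_ mu_ M20 _ uoo uoo).
move=> z; rewrite /dif /usqr subr_sqr normrM mulrC.
have le1 : `|u z.1 + u z.2| <= 2 * M.
  by apply: le_trans (ler_normD _ _) _; have := uM z.1; have := uM z.2; lra.
have := normr_ge0 (u z.1 - u z.2); have := normr_ge0 (u z.1 + u z.2).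
move: le1; move: `|u z.1 + u z.2| `|u z.1 - u z.2| => a b; nra.
Qed.

Lemma test_function_rinv (e : R) (phi : E -> R) : 0 < e -> smooth phi ->
  test_function D (fun x => u x ^+ 2 * rinv e (phi x)).
Proof.
move=> e0 sphi; apply: (test_functionMl tu2).
apply: (smooth_inv_sqrt (f := fun x => rinv_den e (phi x))).
  by move=> x; exact: rinv_den_gt0.
rewrite (_ : (fun x => _) = cst (1 + e ^+ 2) *
    ((phi + cst e) * (phi + cst e) + cst (e ^+ 4))); last first.
  by apply/funext => x; rewrite /rinv_den !fctE expr2.
have sc (c : R) : smooth (cst c : E -> R) := smooth_cst c.
exact: (smoothM (sc _) (smoothD (smoothM (smoothD sphi (sc e)) (smoothD sphi (sc e))) (sc _))).
Qed.

Lemma minimizer_picone_le (e : R) : 0 < e ->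
  (\int[leb]_(x in D) (v x `^ (q - 1) * (u x ^+ 2 * rinv e (v x)))%:E +
   kint leb K (fun z => dif u z ^+ 2 -
     dif v z * dif (fun x => u x ^+ 2 * rinv e (v x)) z)%R <= fform u)%E.
Proof.
move=> e0; have /andP[q1 _] := q12.
have [M M0 uM] := test_function_bounded tu.
have [phi [tphi phiv phioo phi0]] :=
  minimizer_approx q12 mD vmin mv vD.
have voo := minimizer_form_lty q12 mD vmin mv v0 tu2 usqr_ge0 usqr_lty.
have mphi k := test_function_measurable (tphi k).
pose psi k x := u x ^+ 2 * rinv e (phi k x).
have tpsi k : test_function D (psi k).
  by apply: test_function_rinv => //; have [] := tphi k.
have mpsi k := test_function_measurable (tpsi k).
have psi0 k x : 0 <= psi k x by rewrite mulr_ge0 ?sqr_ge0// ltW// rinv_gt0.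
pose C := 2 * M * e ^- 2 + M ^+ 2 * ((1 + e ^+ 2) * e ^- 2 * e ^- 2).
have e20 : 0 <= e ^- 2 by rewrite invr_ge0 sqr_ge0.
have C0 : 0 <= C.
  rewrite addr_ge0 ?mulr_ge0 ?sqr_ge0 ?(ltW M0)//.
  by rewrite addr_ge0 ?sqr_ge0.
have psiC k z : `|dif (psi k) z| <= C * (`|dif u z| + `|dif (phi k) z|).
  exact: rinv_quotient_lipschitz.
(* From [phi k = v + (phi k - v)], both of finite seminorm. *)
have phikoo k : (fform (phi k) < +oo)%E.
  apply: (form_lipschitz_lty (mphi k) mv _ ler01 _ voo (phioo k)).
    exact: measurable_funB.
  move=> z; rewrite mul1r; apply: le_trans (ler_normD _ _).
  by rewrite le_eqVlt; apply/orP; left; apply/eqP; congr `|_|; rewrite /dif/=; lra.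
apply: (picone_limit mK K0 (phi := phi) (psis := psi) mD C0) => //.
- apply: measurable_funM; first exact: measurable_funX.
  exact: (measurableT_comp (measurable_rinv e0) mv).
- by move=> x; rewrite mulr_ge0 ?sqr_ge0// ltW// rinv_gt0.
- by move=> z; exact: rinv_quotient_lipschitz.
(* Picone's inequality enters only here, for the limit function, because it needs the nonnegativity
   of [v]. *)
- by move=> z; apply: rinv_picone.
- apply: filterS phiv => x px; apply: cvgMr.
  exact: (continuous_cvg _ (continuous_rinv e0 (x := v x)) px).
- move=> k Q mQ Q0 Qge.
  apply: (euler_lagrange_le mK K0 mD q1 mv (mpsi k) mQ v0 (psi0 k) Q0 Qge voo).
  + exact: form_lipschitz_lty (mpsi k) mu_ (mphi k) C0 (psiC k) uoo (phikoo k).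
  + exact: (minimizer_powint_lty q12 mD vmin mv v0).
  + move=> t t0.
    have mvt : measurable_fun setT (fun x => v x + psi k x * t).
      by apply: measurable_funD => //; exact: measurable_funM.
    rewrite -(energyE s q D mv) -(energyE s q D mvt); apply: vmin.2.
    exact: (minimizer_add_admissible vmin mv v0 vD (tpsi k) (psi0 k) (ltW t0)).
Qed.

(* If [v] vanished almost everywhere, comparing with [t u^2] as [t] tends to 0
   would contradict minimality, because [t^q] dominates [t^2]. *)
Lemma minimizer_ae_zero : {ae leb, forall x, v x = 0} ->
  {ae leb, forall x, u x = 0}.
Proof.
move=> vz; have /andP[q1 q2] := q12.
have mu2 := test_function_measurable tu2.
have aedif : {ae (leb \x leb)%E, forall z, dif v z = 0}.
  by apply: filterS (ae_product vz) => z [e1 e2]; rewrite /dif e1 e2 subrr.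
have aoo := usqr_lty; set a := fform usqr in aoo.
set b := powint leb q D usqr.
have a0 : (0 <= a)%E by exact: form_ge0 K0 _.
have b0 : (0 <= b)%E by apply: integral_ge0 => x _; rewrite lee_fin powR_ge0.
(* The energy of [v] is 0, so that of [t u^2], namely [t^2 a / 2 - t^q b / q], is nonnegative. *)
have cmp t : 0 < t -> ((t `^ q / q)%:E * b <= (t ^+ 2 / 2)%:E * a)%E.
  move=> t0; have t0' := ltW t0.
  have mt : measurable_fun setT (fun x => usqr x * t) by exact: measurable_funM.
  have mvt : measurable_fun setT (fun x => v x + usqr x * t) by exact: measurable_funD.
  have := vmin.2 _ (minimizer_add_admissible vmin mv v0 vD tu2 usqr_ge0 t0').
  rewrite (energyE s q D mv) (energyE s q D mvt).
  have vt : {ae leb, forall x, v x + usqr x * t = usqr x * t}.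
    by apply: filterS vz => x ->; rewrite add0r.
  have m0 : measurable_fun setT (fun _ : E => (0 : R)) by exact: measurable_cst.
  rewrite (eq_ae_form s mvt mt vt) (eq_ae_powint q mD mvt mt vt).
  rewrite (eq_ae_form s mv m0 vz) (eq_ae_powint q mD mv m0 vz).
  rewrite form0// (_ : powint leb q D (fun=> 0) = 0%E); last first.
    by apply: integral0_eq => x _; rewrite powR0// gt_eqF.
  have -> : fform (fun x => usqr x * t) = ((t ^+ 2)%:E * a)%E.
    rewrite /a /form -(kintZ leb mK K0 _ _ (sqr_ge0 t)).
    + by apply: eq_integral => z _; congr (_ * _)%:E; rewrite /dif; ring.
    + by apply: measurable_funX; exact: measurable_dif.
    + by move=> z; exact: sqr_ge0.
  have -> : powint leb q D (fun x => usqr x * t) = ((t `^ q)%:E * b)%E.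
    have mp := @measurable_powint _ _ q D _ mu2.
    rewrite /b /powint -(ge0_integralZl_EFin _ mD _ mp (powR_ge0 t q)).
      by apply: eq_integral => x _; rewrite powRM// mulrC EFinM.
    by move=> x _; rewrite lee_fin powR_ge0.
  rewrite !mule0 sube0; move: a0 b0 aoo; case: a => [a||]//; case: b => [b||]//.
    rewrite -!EFinM -EFinB !lee_fin => a0 b0 _; have q00 := q0 => le0.
    have -> : t `^ q / q * b = q^-1 * (t `^ q * b) by ring.
    have -> : t ^+ 2 / 2 * a = 2^-1 * (t ^+ 2 * a) by ring.
    by lra.
  by rewrite !gt0_muley ?lte_fin ?divr_gt0 ?powR_gt0 ?invr_gt0//.
have bz : b = 0%E.
  (* An infinite [b] is excluded by the comparison at [t = 1], as [a] is finite. *)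
  move: cmp a0 b0 aoo; case: a => [a||]//; case: b => [b||]//; last first.
    move=> /(_ 1 ltr01); rewrite gt0_muley ?lte_fin ?divr_gt0 ?powR_gt0//.
  move=> cmp; rewrite !lee_fin => a0 b0 _; congr EFin; apply/eqP.
  rewrite eq_le b0 andbT leNgt; apply/negP => b_gt0.
  have q00 := q0; have qa : 0 < q * a + 1 by have := mulr_ge0 (ltW q0) a0; lra.
  (* Chosen so that [t^(2-q) = b / (q a + 1)]. After division by [t^q] the comparison reads
     [b / q <= (b / q) * (q a / (2 (q a + 1)))], whose last factor is below 1; the [+ 1] covers
     [a = 0]. *)
  pose t := (b / (q * a + 1)) `^ (2 - q)^-1.
  have t0 : 0 < t by rewrite powR_gt0// divr_gt0.
  have t2q : t `^ (2 - q) = b / (q * a + 1).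
    by rewrite -powRrM mulVf ?powRr1 ?divr_ge0 ?(ltW qa)//; apply/eqP; lra.
  have := cmp t t0; rewrite -!EFinM lee_fin.
  have -> : t ^+ 2 = t `^ q * t `^ (2 - q).
    rewrite -powRD; last by rewrite (gt_eqF t0) implybT.
    by rewrite (_ : q + (2 - q) = 2%:R) ?powR_mulrn ?ltW//; lra.
  rewrite t2q; have tq : 0 < t `^ q by rewrite powR_gt0.
  have -> : t `^ q / q * b = t `^ q * (b / q) by ring.
  have -> : t `^ q * (b / (q * a + 1)) / 2 * a = t `^ q * (b / (q * a + 1) / 2 * a) by ring.
  rewrite ler_pM2l// leNgt => /negP; apply.
  have -> : b / (q * a + 1) / 2 * a = b / q * (q * a / (2 * (q * a + 1))).
    by field; apply/andP; split; rewrite ?gt_eqF//; lra.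
  rewrite gtr_pMr ?divr_gt0// ltr_pdivrMr ?mulr_gt0//.
  by have := mulr_ge0 (ltW q0) a0; lra.
have : (\int[leb]_(x in D) `|(usqr x `^ q)%:E| = 0)%E.
  rewrite -bz; apply: eq_integral => x _.
  by rewrite gee0_abs// lee_fin powR_ge0.
move/(ae_eq_integral_abs _ mD (@measurable_powint _ _ q D _ mu2)).
apply: filterS => x ux; have [Dx|Dx] := pselect (D x); last exact: test_function_out tu Dx.
have /= [/eqP] := ux Dx.
by rewrite powR_eq0 => /andP[]; rewrite sqrf_eq0 => /eqP.
Qed.

Lemma minimizer_weight_le :
  (\int[leb]_(x in D) ((u x ^+ 2)%:E / ((v x)%:E `^ (2 - q))) <= fform u)%E.
Proof.
apply: (weighted_le_form K0 mD q12 mu_ mv v0).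
  exact: minimizer_picone_le.
have [//|vz] := zero_set_dichotomy mK K0 (@frac_kernel_gt0 R n s) mu_ mv v0 uoo
  minimizer_picone_le.
by apply: filterS (minimizer_ae_zero vz) => x ->.
Qed.

End minimizer_weight.

Lemma energy_minimizer_weight_le (R : realType) (n : nat) (s q : R)
    (D : set 'rV[R]_n) (v u : 'rV[R]_n -> R) :
  1 < q < 2 -> measurable D -> energy_minimizer s q D v -> test_function D u ->
  exists v' : 'rV[R]_n -> R, [/\ measurable_fun setT v', forall x, 0 <= v' x,
    {ae lebesgue_rV n, forall x, v x = v' x} &
    (\int[lebesgue_rV n]_(x in D) ((u x ^+ 2)%:E / ((v' x)%:E `^ (2 - q)))
     <= gagliardo2 s u)%E].
Proof.
move=> q12 mD vmin tu.
have [v' [vmin' mv' v0' vD' vv']] := energy_minimizer_nonneg mD vmin.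
exists v'; split; [exact: mv'|exact: v0'|exact: vv'|].
rewrite (gagliardo2E s (test_function_measurable tu)).
have [->|uoo] := eqVneq (form (lebesgue_rV n) (frac_kernel s) u) +oo%E.
  by rewrite leey.
apply: (minimizer_weight_le q12 mD vmin' mv' v0' vD' tu).
by rewrite ltey.
Qed.

(** * Limits of densities *)

(** Three regimes: at [l = +oo] the agreement makes [W] vanish; at [l = 0] the weights diverge to
    [W = +oo] unless [c = 0]; in between the power is continuous. The disjunction has the shape
    expected by [ae_fatou_le]. *)
Lemma cvg_weight (R : realType) (p c : R) (a : R^nat) (l : \bar R) : 0 < p ->
  (forall k, 0 <= a k) -> ((a k)%:E @[k --> \oo] --> l)%E ->
  let W := (if l == +oo then 0 else (c ^+ 2)%:E / (l `^ p))%E in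
  (((c ^+ 2)%:E / ((a k)%:E `^ p))%E @[k --> \oo] --> W) \/ W = 0%E.
Proof.
move=> p0 a0 al.
have l0 : (0 <= l)%E by apply: cvge_ge al; apply: nearW => k; rewrite lee_fin.
case: l al l0 => [l||]// al; rewrite ?lee_fin; last by right; rewrite eqxx.
rewrite le_eqVlt => /orP[/eqP l0|l0] W.
  have [c0|c0] := eqVneq c 0.
    by right; rewrite /W c0 expr0n/= mul0e.
  left; have c20 : 0 < c ^+ 2 by rewrite exprn_even_gt0.
  have -> : W = +oo%E.
    rewrite /W -l0 poweR0r; last by rewrite gt_eqF.
    by rewrite /= inve0 gt0_muley// lte_fin.
  apply/cvgeyPge => A.
  pose B := Num.max A 1.
  have B0 : 0 < B by rewrite lt_max ltr01 orbT.
  (* The threshold below which [a k] makes the weight at least [B >= A]; the maximum with 1 keeps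
     [B] positive. *)
  pose t := (c ^+ 2 / B) `^ p^-1.
  have t0 : 0 < t by apply: powR_gt0; exact: divr_gt0.
  have tp : t `^ p = c ^+ 2 / B.
    by rewrite -powRrM mulVf ?gt_eqF// powRr1// divr_ge0 ?ltW.
  move: al; rewrite -l0 => /fine_cvgP[_ /cvgrPdist_lt/(_ t t0)].
  apply: filterS => k /=; rewrite sub0r normrN ger0_norm// => akt.
  rewrite inver; case: ifPn => [_|ak0].
    by rewrite gt0_muley ?lte_fin// leey.
  have ak : 0 < a k `^ p by rewrite lt_neqAle eq_sym ak0 powR_ge0.
  rewrite -EFinM lee_fin; apply: (@le_trans _ _ B); first by rewrite le_max lexx.
  rewrite ler_pdivlMr// mulrC -ler_pdivlMr// -tp.
  by apply: ge0_ler_powR; rewrite ?nnegrE// ltW.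
left; rewrite /W/= inver gt_eqF ?powR_gt0// -EFinM.
have ca : a @ \oo --> l by case/fine_cvgP : al.
have cpow : {for l, continuous (fun t : R => t `^ p)}.
  apply: differentiable_continuous; apply/derivable1_diffP.
  by apply: derivable_powR; rewrite in_itv/= l0.
have cinv : (c ^+ 2 * (a k `^ p)^-1)%:E @[k --> \oo] --> (c ^+ 2 * (l `^ p)^-1)%:E.
  apply: cvg_EFin_seq; apply: cvgMr; apply: cvgV; first by rewrite gt_eqF ?powR_gt0.
  exact: (continuous_cvg _ cpow ca).
apply: cvg_trans cinv; apply: near_eq_cvg.
have /cvgrPdist_lt/(_ l l0) := ca; apply: filterS => k akl.
have ak : 0 < a k.
  by have := le_lt_trans (ler_norm _) akl; lra.
by rewrite /= inver gt_eqF ?powR_gt0// -EFinM.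
Qed.

Lemma measurable_weight (d : measure_display) (T : measurableType d) (R : realType)
    (p : R) (u : T -> R) (w : T -> \bar R) :
  measurable_fun setT u -> measurable_fun setT w ->
  measurable_fun setT
    (fun x => if w x == +oo then 0 else (u x ^+ 2)%:E / (w x `^ p))%E.
Proof.
move=> mu_ mw; apply: measurable_fun_ifT => //; first exact: measurable_fun_eqe.
apply: emeasurable_funM; first by apply/measurable_EFinP; exact: measurable_funX.
apply: measurable_inve_ge0 => [|x]; last exact: poweR_ge0.
exact: (measurableT_comp (measurable_poweR p) mw).
Qed.

Lemma weight_ge0 (R : realType) (p c : R) (l : \bar R) :
  (0 <= if l == +oo then 0 else (c ^+ 2)%:E / (l `^ p))%E.
Proof.
by case: ifP => // _; rewrite mule_ge0 ?lee_fin ?sqr_ge0// inve_ge0 poweR_ge0.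
Qed.

Lemma supp_eball (R : realType) (n : nat) (D : set 'rV[R]_n) (u : 'rV[R]_n -> R) :
  test_function D u -> exists N : nat, forall r : R, N%:R <= r -> supp u `<=` eball r.
Proof.
move=> tu; have [M M0 uM] := test_function_supp_bounded tu.
(* Compactness bounds each coordinate by [M]; [B] is the Euclidean length of the corner
   [(M, ..., M)]. *)
pose B : R := Num.sqrt (\sum_(i < n) M ^+ 2).
exists (Num.bound B) => r Br x ux.
have B0 : 0 <= B by exact: sqrtr_ge0.
rewrite /eball/=; apply: lt_le_trans Br; apply: (le_lt_trans _ (archi_boundP B0)).
rewrite ler_wsqrtr//; apply: ler_sum => i _.
by rewrite -(real_normK (num_real (x _ _))) ler_pXn2r ?nnegrE ?(ltW M0)//; exact: uM.
Qed.

Theorem proposition5p1 (R : realType) (N : nat) (s q : R)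
    (Omega : set 'rV[R]_N) (u : 'rV[R]_N -> R) (w : 'rV[R]_N -> \bar R) :
  (1 <= N)%N -> 0 < s < 1 -> 1 < q < 2 ->
  open Omega -> test_function Omega u ->
  lane_emden_density s q Omega w ->
  (\int[lebesgue_rV N]_(x in Omega)
      (if w x == +oo then 0 else (u x ^+ 2)%:E / (w x `^ (2 - q)))
   <= \int[lebesgue_rV N]_x \int[lebesgue_rV N]_y
      ((u x - u y) ^+ 2 / enorm (x - y) `^ (N%:R + 2 * s))%:E)%E.
Proof.
move=> _ _ q12 oOmega tu [mw wP]; have /andP[q1 q2] := q12.
have mO := open_measurable_rV oOmega.
have mu_ := test_function_measurable tu.
have mW := measurable_weight (2 - q) mu_ mw.
rewrite -[leRHS]/(gagliardo2 s u).
have mQ (a : 'rV[R]_N -> R) : measurable_fun setT a ->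
    measurable_fun setT (fun x => (u x ^+ 2)%:E / ((a x)%:E `^ (2 - q)))%E.
  move=> ma; have mae : measurable_fun setT (fun x => (a x)%:E) by exact/measurable_EFinP.
  exact: (measurable_weight (2 - q) mu_ mae).
have Q0 (a : 'rV[R]_N -> R) x : (0 <= (u x ^+ 2)%:E / ((a x)%:E `^ (2 - q)))%E.
  exact: (weight_ge0 (2 - q) (u x) (a x)%:E).
case: wP => [[_ [v vmin wv]]|[v vmin vw]].
  have [v' [mv' v0' vv' le]] := energy_minimizer_weight_le q12 mO vmin tu.
  apply: le_trans le; rewrite le_eqVlt; apply/orP; left; apply/eqP.
  apply: ge0_ae_eq_integral => //.
  - exact: measurable_funTS.
  - by apply: measurable_funTS; exact: mQ.
  - by move=> x _; exact: weight_ge0.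
  - by apply: filterS2 wv vv' => x -> -> _.
have [M supM] := supp_eball tu.
(* The shift makes every radius positive and every ball large enough to contain the support of
   [u]. *)
pose r k : R := (k + M.+1)%:R.
have r0 k : 0 < r k by rewrite /r ltr0n addnS.
have mD k : measurable (Omega `&` eball (r k)).
  by apply: measurableI => //; exact: measurable_eball.
have tuk k : test_function (Omega `&` eball (r k)) u.
  have [su cu uO] := tu; split=> // x ux; split; first exact: uO.
  by apply: supM ux; rewrite ler_nat addnS leqW// leq_addl.
have /choice[v' v'P] k :=
  energy_minimizer_weight_le q12 (mD k) (vmin (r k) (r0 k)) (tuk k).
have mv' k : measurable_fun setT (v' k) by have [] := v'P k.
(* Passing to countably many radii lets the exceptional sets of all the representatives be united
   into one null set. *)
have aev' : {ae lebesgue_rV N, forall x, forall k, v (r k) x = v' k x}.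
  by apply: ae_foralln => k; have [] := v'P k.
have rcvg : r k @[k --> \oo] --> +oo%R.
  have := @cvgr_idn R; rewrite -(cvg_shiftn M.+1); exact.
apply: (@ae_fatou_le _ _ _ (lebesgue_rV N) Omega
  (fun k x => (u x ^+ 2)%:E / ((v' k x)%:E `^ (2 - q)))%E _ (fun=> gagliardo2 s u)) => //.
- by move=> k; apply: measurable_funTS; exact: mQ.
- exact: measurable_funTS.
- by move=> x _; exact: weight_ge0.
- apply: filterS2 vw aev' => x vwx v'x _.
  have p0 : 0 < 2 - q by rewrite subr_gt0.
  apply: cvg_weight => // [k|]; first by have [] := v'P k.
  have -> : (fun k => (v' k x)%:E) = (fun k => (v (r k) x)%:E).
    by apply/funext => k; rewrite v'x.
  exact: (cvg_comp _ _ rcvg vwx).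
- move=> k; have [_ _ _] := v'P k; apply: le_trans.
  (* The integrals over [Omega] and over its part in the ball agree: [u] vanishes outside that part,
     and the integrand is 0 wherever [u] is, even if its weight is infinite. *)
  rewrite le_eqVlt; apply/orP; left; apply/eqP.
  rewrite (integral_mkcond Omega) [RHS]integral_mkcond.
  apply: eq_integral => x _; rewrite !patchE.
  have [ux|ux] := eqVneq (u x) 0.
    by rewrite ux expr0n/= mul0e; case: ifP; case: ifP.
  have sux : supp u x by exact: subset_closure.
  have [_ _ uk] := tuk k; have [Ox ex] := uk _ sux.
  by rewrite !mem_set.
- exact: cvg_cst.
Qed.
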